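(* Let $L=2U\oplus L_0$ be an even lattice of signature $(2,n)$, $n\ge3$, such that every isotropic subgroup of its discriminant group is cyclic. Let $F$ be a modular form with respect to $\widetilde{\mathrm O}^+(L)$, with Fourier expansion at the standard $0$-dimensional cusp $F(Z)=\sum_{l\in L_1^\vee,\ (l,l)\ge 0}a(l)\exp(2\pi i(l,Z))$. If $a(l)=0$ for all $l$ with $(l,l)=0$, then $F$ is a cusp form.
   Context: $U$ is the hyperbolic plane; the discriminant group is $A_L=L^\vee/L$ with quadratic form $q_L$ with values in $\mathbb Q/2\mathbb Z$, and isotropic means $q_L$ vanishes on the subgroup. $\mathcal D_L$ is one of the two components of $\{[w]\in\mathbb P(L\otimes\mathbb C)\mid (w,w)=0,(w,\bar w)>0\}$, $\widetilde{\mathrm O}^+(L)$ the subgroup of $\mathrm O(L)$ preserving $\mathcal D_L$ and acting trivially on $A_L$. A modular form of weight $k$ (trivial character) is a holomorphic function on the affine cone over $\mathcal D_L$, homogeneous of degree $-k$ and invariant under the group; a cusp form vanishes at all boundary components of the Baily–Borel compactification. The standard $0$-dimensional cusp is defined by a primitive isotropic $u\in L$ with $(u,L)=\mathbb Z$; with $L_1=u^\perp/\mathbb Zu\cong U\oplus L_0$, $\mathcal D_L$ is identified with the tube domain $\mathcal H(L_1)=\{Z\in L_1\otimes\mathbb C\mid (\mathrm{Im} Z,\mathrm{Im} Z)>0\}^+$ (a connected component), on which modular forms are invariant under $Z\mapsto Z+l$, $l\in L_1$, giving the stated Fourier expansion. *)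

(* Defs.v *)
From HB Require Import structures.
From mathcomp Require Import all_boot all_order all_algebra.
From mathcomp Require Import all_classical all_reals all_analysis.
From mathcomp Require Import complex.
Set Implicit Arguments. Unset Strict Implicit. Unset Printing Implicit Defensive.
Import Order.TTheory GRing.Theory Num.Theory.
Import numFieldTopology.Exports numFieldNormedType.Exports.
Local Open Scope ring_scope.
Local Open Scope complex_scope.
Local Open Scope classical_set_scope.

(* Lattices in coordinates.  L0 = Z^m with Gram matrix S0 (m = n - 2),    *)
(* U = hyperbolic plane (Gram [[0,1],[1,0]]), L1 = U + L0 (rank n = 2+m), *)
(* L = U + L1 = 2U + L0 (rank 2 + (2 + m)).  Vectors are row vectors.     *)

Definition intr {K : pzRingType} (z : int) : K := z%:~R.

Definition GramU : 'M[int]_2 := \matrix_(i < 2, j < 2) (i != j)%:R.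

Definition Gram1 (m : nat) (S0 : 'M[int]_m) : 'M[int]_(2 + m) :=
  block_mx GramU 0 0 S0.

Definition GramL (m : nat) (S0 : 'M[int]_m) : 'M[int]_(2 + (2 + m)) :=
  block_mx GramU 0 0 (Gram1 S0).

Definition bil {K : pzRingType} (k : nat) (G : 'M[int]_k) (v w : 'rV[K]_k) : K :=
  (v *m map_mx intr G *m w^T) 0 0.

(* S0 is the Gram matrix of an even lattice L0 which is negative definite,
   i.e. L = 2U + L0 is even of signature (2, n) with n = m + 2. *)
Definition even_negdef_gram (R : realType) (m : nat) (S0 : 'M[int]_m) : Prop :=
  S0^T = S0 /\ (forall i, (2 %| S0 i i)%Z) /\
  (forall v : 'rV[R]_m, v != 0 -> bil S0 v v < 0).

Definition inLat (k : nat) (v : 'rV[rat]_k) : Prop :=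
  exists z : 'rV[int]_k, v = map_mx intr z.

(* v in L^v  <=>  (v, x) in Z for all x in L  <=>  v G integral *)
Definition inDual (k : nat) (G : 'M[int]_k) (v : 'rV[rat]_k) : Prop :=
  inLat (v *m map_mx intr G).

(* Subgroups of A_L = L^v/L are represented by their preimages H,
   L <= H <= L^v; H/L is isotropic iff q(h) = (h,h) = 0 in Q/2Z for h in H;
   H/L is cyclic iff it is generated by the class of one element. *)
Definition isotropic_subgroups_cyclic (k : nat) (G : 'M[int]_k) : Prop :=
  forall H : 'rV[rat]_k -> Prop,
    (forall v, inLat v -> H v) ->
    (forall v, H v -> inDual G v) ->
    (forall v w, H v -> H w -> H (v - w)) ->
    (forall v, H v -> exists z : int, bil G v v = intr (2 * z)) ->
    exists g, H g /\ forall h, H h -> exists c : int, inLat (h - g *~ c).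

HB.instance Definition _ (R : realType) :=
  PseudoPointedMetric.copy R[i] (R[i])^o.

Section Complex.
Variable R : realType.
Local Notation C := R[i].

Definition Cr (x : R) : C := x%:C.
Definition ratC (q : rat) : C := ratr q.

Definition ImV (k : nat) (Z : 'rV[C]_k) : 'rV[R]_k := map_mx (@complex.Im R) Z.

Definition posCone (m : nat) (S0 : 'M[int]_m) (Y : 'rV[R]_(2 + m)) : Prop :=
  0 < bil (Gram1 S0) Y Y /\ 0 < Y 0 (lshift m (0 : 'I_2)).

Definition closPosConeQ (m : nat) (S0 : 'M[int]_m) (Y : 'rV[rat]_(2 + m)) : Prop :=
  Y != 0 /\ 0 <= bil (Gram1 S0) Y Y /\
  0 <= Y 0 (lshift m (0 : 'I_2)) /\ 0 <= Y 0 (lshift m (1 : 'I_2)).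

Definition inTube (m : nat) (S0 : 'M[int]_m) (Z : 'rV[C]_(2 + m)) : Prop :=
  posCone S0 (ImV Z).

(* Z |-> w(Z) = (-(Z,Z)/2) e' + f' + Z in L (x) C, for the standard cusp
   u = e' (e', f' the basis of the first U summand of L = U + L1) *)
Definition wZ (m : nat) (S0 : 'M[int]_m) (Z : 'rV[C]_(2 + m)) : 'rV[C]_(2 + (2 + m)) :=
  row_mx (\row_(i < 2) if i == 0 then - (bil (Gram1 S0) Z Z) / 2%:R else 1) Z.

Definition inConeD (m : nat) (S0 : 'M[int]_m) (v : 'rV[C]_(2 + (2 + m))) : Prop :=
  exists t : C, t != 0 /\ exists Z, inTube S0 Z /\ v = t *: wZ S0 Z.

Definition preservesD (m : nat) (S0 : 'M[int]_m) (g : 'M[C]_(2 + (2 + m))) : Prop :=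
  forall v, inConeD S0 v -> inConeD S0 (v *m g).

Definition inGamma (m : nat) (S0 : 'M[int]_m) (g : 'M[int]_(2 + (2 + m))) : Prop :=
  (exists g' : 'M[int]_(2 + (2 + m)), g *m g' = 1 /\ g' *m g = 1) /\
  g *m GramL S0 *m g^T = GramL S0 /\
  (forall v, inDual (GramL S0) v -> inLat (v *m map_mx intr g - v)) /\
  preservesD S0 (map_mx intr g).

Definition inOplusQ (m : nat) (S0 : 'M[int]_m) (h : 'M[rat]_(2 + (2 + m))) : Prop :=
  h \in unitmx /\ h *m map_mx intr (GramL S0) *m h^T = map_mx intr (GramL S0) /\
  preservesD S0 (map_mx ratC h).

(* Holomorphy on an open subset of C^k: continuous and holomorphic in each *)
(* variable separately (equivalent to joint holomorphy by Osgood/Hartogs). *)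

Definition holomorphic_on (k : nat) (D : set 'rV[C]_k) (f : 'rV[C]_k -> C) : Prop :=
  (forall Z, D Z -> forall e : R, 0 < e -> exists2 d : R, 0 < d &
      forall Z' : 'rV[C]_k, (forall i, `|Z' 0 i - Z 0 i| < Cr d) -> `|f Z' - f Z| < Cr e) /\
  (forall Z, D Z -> forall j : 'I_k, exists d : C,
      (fun h : C => (f (Z + h *: delta_mx 0 j) - f Z) / h) @ (0 : C)^' --> d).

(* modular form of weight k for \tilde O^+(L), trivial character, as a
   function on L (x) C (only its values on the affine cone matter) *)
Definition isModularForm (m : nat) (S0 : 'M[int]_m) (k : int)
    (F : 'rV[C]_(2 + (2 + m)) -> C) : Prop :=
  holomorphic_on
    (fun p : 'rV[C]_(1 + (2 + m)) => p 0 (lshift _ 0) != 0 /\ inTube S0 (rsubmx p))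
    (fun p => F (p 0 (lshift _ 0) *: wZ S0 (rsubmx p))) /\
  (forall (t : C) v, t != 0 -> inConeD S0 v -> F (t *: v) = t ^ (- k) * F v) /\
  (forall g, inGamma S0 g -> forall v, inConeD S0 v -> F (v *m map_mx intr g) = F v).

Definition ee (x : C) : C :=
  Cr (expR (- (2 * pi * complex.Im x))) *
  (Cr (cos (2 * pi * complex.Re x)) + 'i * Cr (sin (2 * pi * complex.Re x))).

Definition dualvec (m : nat) (S0 : 'M[int]_m) (c : 'rV[int]_(2 + m)) : 'rV[rat]_(2 + m) :=
  map_mx intr c *m invmx (map_mx intr (Gram1 S0)).

Definition box_sum (k : nat) (N : nat) (g : 'rV[int]_k -> C) : C :=
  \sum_(c : {ffun 'I_k -> 'I_(N.*2.+1)}) g (\row_i ((c i : nat)%:Z - N%:Z)).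

Definition FourierExpansion (m : nat) (S0 : 'M[int]_m)
    (F : 'rV[C]_(2 + (2 + m)) -> C) (a : 'rV[rat]_(2 + m) -> C) : Prop :=
  (forall l, inDual (Gram1 S0) l -> a l != 0 -> 0 <= bil (Gram1 S0) l l) /\
  forall Z, inTube S0 Z ->
    let term c := a (dualvec S0 c) *
                  ee (bil (Gram1 S0) (map_mx ratC (dualvec S0 c)) Z) in
    (exists B : C, forall N, box_sum N (fun c => `|term c|) <= B) /\
    (fun N => box_sum N term) @ \oo --> F (wZ S0 Z).

(* Cusp forms: F vanishes at every boundary component of the Baily-Borel  *)
(* compactification, i.e. every Siegel Phi-limit is 0: moving any rational*)
(* boundary component to the standard cusp by h in O^+(L (x) Q), the limit*)
(* along Z + i t Y0 (t -> +oo), Y0 rational in the closed positive cone,  *)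
(* is 0.  Y0 interior gives the 0-dim cusp, Y0 isotropic gives the point  *)
(* of the 1-dim boundary component for the plane <e', Y0>.                *)

Definition isCuspForm (m : nat) (S0 : 'M[int]_m) (F : 'rV[C]_(2 + (2 + m)) -> C) : Prop :=
  forall h : 'M[rat]_(2 + (2 + m)), inOplusQ S0 h ->
  forall Z, inTube S0 Z ->
  forall Y0 : 'rV[rat]_(2 + m), closPosConeQ S0 Y0 ->
    (fun t : R => F (wZ S0 (Z + (Cr t * 'i) *: map_mx ratC Y0) *m map_mx ratC h))
      @ +oo --> (0 : C).

End Complex.

(* Main.v *)
(* A rational isotropic plane E meets the dual lattice in a group that is cyclic modulo
   L, hence contains a lattice vector u with (u, L) = Z.  By the Eichler criterion u is
   moved to e' by transvections, so every boundary curve is adjacent, modulo Gamma, to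
   the standard cusp, and along it F becomes a power series in one variable q whose
   coefficients are partial sums of the given Fourier expansion.  By Koecher's principle
   and the hypothesis, only l in the open positive cone contribute, so that the series has
   no constant term and F tends to 0 at the boundary curves.  A positive direction is a
   sum Y1 + Y2 of isotropic ones: in both variables s1, s2 the function
   F(Z + s1 Y1 + s2 Y2) is a power series without constant term, and Schwarz's lemma,
   applied in each variable, reduces the decay to a bound on a compact torus.  Cauchy's
   integral and Schwarz's lemma are replaced by averages over roots of unity. *)

From HB Require Import structures.
From mathcomp Require Import all_boot all_order all_algebra.
From mathcomp Require Import all_classical all_reals all_analysis.
From mathcomp Require Import complex ring lra zify.
(* Last, because mathcomp also exports names such as [intr]. *)
Require Import Defs.
Set Implicit Arguments. Unset Strict Implicit. Unset Printing Implicit Defensive.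
Import Order.TTheory GRing.Theory Num.Theory.
Import numFieldTopology.Exports numFieldNormedType.Exports.
Local Open Scope ring_scope.

Local Notation ImV := Defs.ImV.

(** The hypothesis on [a] concerns the standard cusp alone, while decay is required at every
    rational boundary point. A 0-dimensional cusp not equivalent to the standard one has no
    expansion at hand; it is approached through the boundary curves that meet it, whence the
    two-variable argument. For that argument the period [D] of the one-variable series must depend
    on the direction alone and not on the base point [Z]: shifting the base point along the other
    direction then keeps the period, and a bound on one rectangle of periods is a bound for all real
    parameters. Cyclicity helps because the dual vectors of the plane have rank two: correcting by
    multiples of one generator spoils only one direction, and primitivity can be read off in the
    other. The condition (l,l) >= 0 on the support leaves both halves of the cone; Koecher's
    principle discards the negative half. The Fourier series is known only through absolutely
    bounded box sums, so each analytic step is an exact identity on a finite box plus a tail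
    estimate. *)

HB.instance Definition _ (K : pzRingType) := GRing.RMorphism.copy (@intr K) (intmul (1 : K)).

(** * Bilinear forms and transvections *)

Section Bilinear.
Variables (K : comNzRingType) (k : nat) (G : 'M[int]_k).
Implicit Types (u v w x y : 'rV[K]_k) (a q : K).

Lemma bilDl u v w : bil G (u + v) w = bil G u w + bil G v w.
Proof. by rewrite /bil !mulmxDl mxE. Qed.

Lemma bilDr u v w : bil G u (v + w) = bil G u v + bil G u w.
Proof. by rewrite /bil linearD /= mulmxDr mxE. Qed.

Lemma bilZl a u v : bil G (a *: u) v = a * bil G u v.
Proof. by rewrite /bil -!scalemxAl mxE. Qed.

Lemma bilZr a u v : bil G u (a *: v) = a * bil G u v.
Proof. by rewrite /bil linearZ /= -scalemxAr mxE. Qed.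

Lemma bilNl u v : bil G (- u) v = - bil G u v.
Proof. by rewrite -scaleN1r bilZl mulN1r. Qed.

Lemma bilNr u v : bil G u (- v) = - bil G u v.
Proof. by rewrite -scaleN1r bilZr mulN1r. Qed.

Lemma bil0l v : bil G 0 v = 0.
Proof. by rewrite -(scale0r v) bilZl mul0r. Qed.

Lemma bil0r v : bil G v 0 = 0.
Proof. by rewrite -(scale0r v) bilZr mul0r. Qed.

Definition bilE := (bilDl, bilDr, bilNl, bilNr, bilZl, bilZr, bil0l, bil0r).

Lemma bilC (symG : G^T = G) u v : bil G u v = bil G v u.
Proof.
rewrite /bil -[in LHS](trmxK (u *m _ *m _)) mxE !trmx_mul trmxK map_trmx symG.
by rewrite mulmxA.
Qed.

Lemma bil_scalar u v : u *m map_mx intr G *m v^T = (bil G u v)%:M.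
Proof. by rewrite [LHS]mx11_scalar. Qed.

Lemma bil_mul (h : 'M[K]_k) u v :
  h *m map_mx intr G *m h^T = map_mx intr G -> bil G (u *m h) (v *m h) = bil G u v.
Proof. by move=> hG; rewrite /bil trmx_mul -{2}hG !mulmxA. Qed.

Lemma mx_delta (A : 'M[K]_k) i j :
  (delta_mx (0 : 'I_1) i *m A *m (delta_mx (0 : 'I_1) j)^T) 0 0 = A i j.
Proof. by rewrite -rowE trmx_delta -colE !mxE. Qed.

(* The Eichler transvection t(e,v); [q] stands for (v,v)/2. *)
Definition eichler (e v : 'rV[K]_k) (q : K) : 'M[K]_k :=
  1%:M + map_mx intr G *m e^T *m v - map_mx intr G *m v^T *m e
  - q *: (map_mx intr G *m e^T *m e).

Lemma mul_eichler e v q x :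
  x *m eichler e v q = x + bil G x e *: v - bil G x v *: e - (q * bil G x e) *: e.
Proof.
rewrite /eichler !mulmxBr mulmxDr mulmx1 -scalemxAr !mulmxA !bil_scalar.
by rewrite !mul_scalar_mx scalerA.
Qed.

Hypothesis symG : G^T = G.
Variables (e v : 'rV[K]_k) (q : K).
Hypotheses (ee0 : bil G e e = 0) (ev0 : bil G e v = 0) (vv : bil G v v = q + q).

Lemma bil_eichler x y : bil G (x *m eichler e v q) (y *m eichler e v q) = bil G x y.
Proof.
rewrite !mul_eichler !bilE ee0 vv ev0 (bilC symG v e) ev0.
rewrite (bilC symG e y) (bilC symG v y); ring.
Qed.

Lemma eichler_gram :
  eichler e v q *m map_mx intr G *m (eichler e v q)^T = map_mx intr G.
Proof.
apply/matrixP => i j; rewrite -mx_delta -[RHS]mx_delta.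
have := bil_eichler (delta_mx 0 i) (delta_mx 0 j).
by rewrite /bil trmx_mul !mulmxA.
Qed.

Lemma eichler_mulN : eichler e v q *m eichler e (- v) q = 1%:M.
Proof.
apply/row_matrixP => i; rewrite row_mul rowE mul_eichler mul_eichler.
rewrite row1 !bilE ee0 ev0 vv (bilC symG v e) ev0.
by apply/rowP => j; rewrite !mxE; ring.
Qed.

End Bilinear.

Lemma map_eichler (K K' : comNzRingType) (f : {rmorphism K -> K'}) k (G : 'M[int]_k) e v q :
  map_mx f (eichler G e v q) = eichler G (map_mx f e) (map_mx f v) (f q).
Proof.
rewrite /eichler !map_mxB map_mxD map_mx1 map_mxZ !map_mxM -!map_trmx.
suff -> : map_mx f (map_mx intr G) = map_mx intr G by [].
by apply/matrixP => i j; rewrite !mxE /intr rmorph_int.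
Qed.

Lemma inLatD k (v w : 'rV[rat]_k) : inLat v -> inLat w -> inLat (v + w).
Proof. by move=> [a ->] [b ->]; exists (a + b); rewrite map_mxD. Qed.

Lemma inLatN k (v : 'rV[rat]_k) : inLat v -> inLat (- v).
Proof. by move=> [a ->]; exists (- a); rewrite map_mxN. Qed.

Lemma inLatM k l (v : 'rV[rat]_k) (A : 'M[int]_(k, l)) :
  inLat v -> inLat (v *m map_mx intr A).
Proof. by move=> [a ->]; exists (a *m A); rewrite map_mxM. Qed.

Lemma bil_map (K K' : comNzRingType) (f : {rmorphism K -> K'}) k (G : 'M[int]_k) v w :
  bil G (map_mx f v) (map_mx f w) = f (bil G v w).
Proof.
rewrite /bil map_trmx.
have -> : map_mx (@intr K') G = map_mx f (map_mx intr G).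
  by apply/matrixP => i j; rewrite !mxE /intr rmorph_int.
by rewrite -!map_mxM mxE.
Qed.

Lemma bil_blockU (K : comNzRingType) k (G : 'M[int]_k) (v w : 'rV[K]_(2 + k)) :
  bil (block_mx GramU 0 0 G) v w =
  v 0 (lshift k 0) * w 0 (lshift k 1) + v 0 (lshift k 1) * w 0 (lshift k 0)
  + bil G (rsubmx v) (rsubmx w).
Proof.
rewrite /bil -{1}(hsubmxK v) -{1}(hsubmxK w) map_block_mx !map_mx0 mul_row_block.
rewrite tr_row_mx mul_row_col !mulmx0 addr0 add0r mxE; congr (_ + _).
rewrite !mxE big_ord_recl big_ord1 !mxE !big_ord_recl !big_ord0 !mxE /=.
have -> : lift (0 : 'I_2) (0 : 'I_1) = 1 :> 'I_2 by apply/val_inj.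
by rewrite /intr /= !mulr0z !mulr1z; ring.
Qed.

Lemma rowU_eq (T : Type) k (v w : 'rV[T]_(2 + k)) :
  v 0 (lshift k 0) = w 0 (lshift k 0) -> v 0 (lshift k 1) = w 0 (lshift k 1) ->
  rsubmx v = rsubmx w -> v = w.
Proof.
move=> h0 h1 hr; rewrite -[v]hsubmxK -[w]hsubmxK hr; congr row_mx.
apply/rowP => i; rewrite !mxE.
have [->//|->//] : i = 0 \/ i = 1.
by case: i => [[|[|//]] ?]; [left|right]; apply/val_inj.
Qed.

Lemma row_addE (V : nmodType) k (v w : 'rV[V]_k) i : (v + w) 0 i = v 0 i + w 0 i.
Proof. by rewrite mxE. Qed.

Lemma row_oppE (V : zmodType) k (v : 'rV[V]_k) i : (- v) 0 i = - v 0 i.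
Proof. by rewrite mxE. Qed.

Lemma row_scaleE (K : pzRingType) k (a : K) (v : 'rV[K]_k) i : (a *: v) 0 i = a * v 0 i.
Proof. by rewrite mxE. Qed.

Definition rowE_lin := (row_addE, row_oppE, row_scaleE).

Lemma rsub_addE (V : nmodType) k (v w : 'rV[V]_(2 + k)) :
  rsubmx (v + w) = rsubmx v + rsubmx w.
Proof. by apply/rowP => i; rewrite !mxE. Qed.

Lemma rsub_oppE (V : zmodType) k (v : 'rV[V]_(2 + k)) : rsubmx (- v) = - rsubmx v.
Proof. by apply/rowP => i; rewrite !mxE. Qed.

Lemma rsub_scaleE (K : pzRingType) k (a : K) (v : 'rV[K]_(2 + k)) :
  rsubmx (a *: v) = a *: rsubmx v.
Proof. by apply/rowP => i; rewrite !mxE. Qed.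

Definition rsubE_lin := (rsub_addE, rsub_oppE, rsub_scaleE).

(** * The cone over the domain *)

Section ComplexVectors.
Variable R : realType.
Local Notation C := R[i].
Local Notation toC := (real_complex R).

Definition ReVec (k : nat) (Z : 'rV[C]_k) : 'rV[R]_k := map_mx (@complex.Re R) Z.

Lemma complex_eq (x y : C) :
  complex.Re x = complex.Re y -> complex.Im x = complex.Im y -> x = y.
Proof. by case: x => a b; case: y => c d /= -> ->. Qed.

Lemma Re_add (x y : C) : complex.Re (x + y) = complex.Re x + complex.Re y.
Proof. by case: x; case: y. Qed.
Lemma Im_add (x y : C) : complex.Im (x + y) = complex.Im x + complex.Im y.
Proof. by case: x; case: y. Qed.
Lemma Re_opp (x : C) : complex.Re (- x) = - complex.Re x.
Proof. by case: x. Qed.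
Lemma Im_opp (x : C) : complex.Im (- x) = - complex.Im x.
Proof. by case: x. Qed.
Lemma Re_mul (x y : C) : complex.Re (x * y) =
  complex.Re x * complex.Re y - complex.Im x * complex.Im y.
Proof. by case: x; case: y. Qed.
Lemma Im_mul (x y : C) : complex.Im (x * y) =
  complex.Re x * complex.Im y + complex.Im x * complex.Re y.
Proof. by case: x; case: y. Qed.

Definition ReImE := (Re_add, Im_add, Re_opp, Im_opp, Re_mul, Im_mul).

Lemma vec_ReIm k (x : 'rV[C]_k) :
  x = map_mx toC (ReVec x) + 'i%C *: map_mx toC (ImV x).
Proof. by apply/rowP => i; rewrite !mxE -complexE. Qed.

Lemma ReIm_mulmx k l (x : 'rV[C]_k) (A : 'M[R]_(k, l)) :
  ReVec (x *m map_mx toC A) = ReVec x *m A /\ ImV (x *m map_mx toC A) = ImV x *m A.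
Proof.
rewrite {1 3}(vec_ReIm x) mulmxDl -scalemxAl -!map_mxM.
by split; apply/rowP => i; rewrite !mxE !ReImE /=; ring.
Qed.

Lemma map_intC k l (A : 'M[int]_(k, l)) :
  map_mx (@intr C) A = map_mx toC (map_mx intr A).
Proof. by apply/matrixP => i j; rewrite !mxE /intr rmorph_int. Qed.

Lemma bil_ReIm k (G : 'M[int]_k) (symG : G^T = G) (x : 'rV[C]_k) :
  bil G x x = (bil G (ReVec x) (ReVec x) - bil G (ImV x) (ImV x))%:C%C
    + 2 * 'i%C * (bil G (ReVec x) (ImV x))%:C%C.
Proof.
rewrite {1 2}(vec_ReIm x) !bilE !bil_map (bilC symG (ImV x)).
by apply: complex_eq; rewrite !ReImE /=; ring.
Qed.

End ComplexVectors.

Section Lattice.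
Variables (R : realType) (m : nat) (S0 : 'M[int]_m).
Hypothesis S0P : even_negdef_gram R S0.
Local Notation C := R[i].
Local Notation toC := (real_complex R).
Local Notation L1 := (Gram1 S0).
Local Notation L := (GramL S0).
Local Notation iE := (lshift (2 + m) (0 : 'I_2)).
Local Notation iF := (lshift (2 + m) (1 : 'I_2)).
Local Notation i0 := (rshift 2 (lshift m (0 : 'I_2))).
Local Notation i1 := (rshift 2 (lshift m (1 : 'I_2))).

Lemma symGramU : GramU^T = GramU.
Proof. by apply/matrixP => i j; rewrite !mxE eq_sym. Qed.

Lemma symGram1 : L1^T = L1.
Proof. by rewrite /Gram1 tr_block_mx !trmx0 symGramU; case: S0P => ->. Qed.

Lemma symGramL : L^T = L.
Proof. by rewrite /GramL tr_block_mx !trmx0 symGramU symGram1. Qed.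

Lemma bil1E (K : comNzRingType) (v w : 'rV[K]_(2 + m)) : bil L1 v w =
  v 0 (lshift m 0) * w 0 (lshift m 1) + v 0 (lshift m 1) * w 0 (lshift m 0)
  + bil S0 (rsubmx v) (rsubmx w).
Proof. exact: bil_blockU. Qed.

Lemma bilLE (K : comNzRingType) (v w : 'rV[K]_(2 + (2 + m))) : bil L v w =
  v 0 iE * w 0 iF + v 0 iF * w 0 iE + bil L1 (rsubmx v) (rsubmx w).
Proof. exact: bil_blockU. Qed.

Lemma negdef_le0 (v : 'rV[R]_m) : bil S0 v v <= 0.
Proof.
have [->|v0] := eqVneq v 0; first by rewrite bil0l.
by case: S0P => _ [_ /(_ v v0)/ltW].
Qed.

Lemma negdef_eq0 (v : 'rV[R]_m) : 0 <= bil S0 v v -> v = 0.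
Proof.
move=> h; apply/eqP/negPn/negP => v0.
by case: S0P => _ [_ /(_ v v0)]; rewrite ltNge h.
Qed.

Lemma even_S0 (z : 'rV[int]_m) : exists q : int, bil S0 z z = q + q.
Proof.
case: S0P => symS [ev _]; rewrite (row_sum_delta z).
elim/big_ind: _ => [|x y [a xa] [b yb]|i _].
- by exists 0; rewrite bil0l.
- by exists (a + b + bil S0 x y); rewrite !bilE xa yb (bilC symS y x); ring.
have /dvdzP[q hq] := ev i; exists (z 0 i * z 0 i * q).
rewrite !bilE /bil mx_delta mxE /intr intz hq; ring.
Qed.

Lemma even_L1 (z : 'rV[int]_(2 + m)) : exists q : int, bil L1 z z = q + q.
Proof.
have [q hq] := even_S0 (rsubmx z).
by exists (z 0 (lshift m 0) * z 0 (lshift m 1) + q); rewrite bil1E hq; ring.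
Qed.

Lemma even_L (z : 'rV[int]_(2 + (2 + m))) : exists q : int, bil L z z = q + q.
Proof.
have [q hq] := even_L1 (rsubmx z).
by exists (z 0 iE * z 0 iF + q); rewrite bilLE hq; ring.
Qed.

Lemma rsub_wZ (Z : 'rV[C]_(2 + m)) : rsubmx (wZ S0 Z) = Z.
Proof. by rewrite /wZ row_mxKr. Qed.

Lemma wZ_F (Z : 'rV[C]_(2 + m)) : wZ S0 Z 0 iF = 1.
Proof. by rewrite /wZ row_mxEl mxE. Qed.

Lemma wZ_E (Z : 'rV[C]_(2 + m)) : wZ S0 Z 0 iE = - bil L1 Z Z / 2.
Proof. by rewrite /wZ row_mxEl mxE. Qed.

Lemma wZ_isotropic (Z : 'rV[C]_(2 + m)) : bil L (wZ S0 Z) (wZ S0 Z) = 0.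
Proof. by rewrite bilLE rsub_wZ wZ_E wZ_F mulr1 mul1r -splitr addNr. Qed.

(** Isotropy forces the [e'] coordinate: 2 x_E x_F + (x',x') = 0 with x' the part in L1, so x' / x_F
    determines the line of x. *)
Lemma isotropic_wZ (x : 'rV[C]_(2 + (2 + m))) : bil L x x = 0 -> x 0 iF != 0 ->
  x = x 0 iF *: wZ S0 ((x 0 iF)^-1 *: rsubmx x).
Proof.
move=> xx xF; apply: rowU_eq; rewrite ?rowE_lin ?wZ_E ?wZ_F ?mulr1 //; last first.
  by rewrite linearZ /= rsub_wZ scalerA mulfV // scale1r.
have : x 0 iE * x 0 iF *+ 2 = - bil L1 (rsubmx x) (rsubmx x).
  by apply/eqP; rewrite -addr_eq0 -[X in _ == X]xx bilLE; apply/eqP; ring.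
rewrite !bilE => e; rewrite -[RHS]mulr1.
apply: (mulIf xF); apply: (@mulIf _ 2) => //.
by move: e; rewrite -mulr_natr => ->; field.
Qed.

(* [X + iY] spans a point of the domain or of its conjugate iff [X, Y] is an
   orthogonal basis of equal positive norms; the determinant of the pairings of [X, Y]
   with the isotropic plane spanned by [e'] and the second basis vector of the second
   [U] never vanishes there, so that its sign distinguishes the two components. *)
Definition cone_pair (X Y : 'rV[R]_(2 + (2 + m))) : Prop :=
  [/\ bil L X X = bil L Y Y, bil L X Y = 0 & 0 < bil L X X].

Definition cone_det (X Y : 'rV[R]_(2 + (2 + m))) : R :=
  X 0 iF * Y 0 i0 - Y 0 iF * X 0 i0.

(** If the determinant vanished, a nontrivial combination W of X and Y would have zero coordinates
    at [iF] and [i0]. Then only L0 contributes to (W,W), which is <= 0, although the span of X and Y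
    is positive definite. *)
Lemma cone_det_neq0 X Y : cone_pair X Y -> cone_det X Y != 0.
Proof.
case=> XY XY0 XX; apply/eqP => d0.
have key s t : s * X 0 iF + t * Y 0 iF = 0 -> s * X 0 i0 + t * Y 0 i0 = 0 ->
    s = 0 /\ t = 0.
  move=> hF h0; pose W := s *: X + t *: Y.
  have : bil L W W <= 0.
    rewrite bilLE bil1E !mxE hF h0 !mulr0 !mul0r !add0r.
    exact: negdef_le0.
  rewrite !bilE XY0 (bilC symGramL Y X) XY0 -XY !mulr0 add0r addr0.
  rewrite !mulrA -mulrDl pmulr_lle0 // => h.
  have s2 := sqr_ge0 s; have t2 := sqr_ge0 t; rewrite !expr2 in s2 t2.
  have /eqP : s * s = 0 by lra.
  have /eqP : t * t = 0 by lra.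
  by rewrite !mulf_eq0 !orbb => /eqP-> /eqP->.
have [||YF XF] := key (Y 0 iF) (- X 0 iF); first by ring.
  by rewrite -[RHS]oppr0 -d0 /cone_det; ring.
have [||Y0 X0] := key (Y 0 i0) (- X 0 i0).
- by rewrite -[RHS]d0 /cone_det; ring.
- by ring.
have [||/eqP] := key 1 0; last by rewrite oner_eq0.
- by rewrite -[X 0 iF]opprK XF; ring.
- by rewrite -[X 0 i0]opprK X0; ring.
Qed.

(** Multiplication by t = a + ib acts on the pair (Re x, Im x) as a rotation and dilation, so norms
    and determinant are multiplied by a^2 + b^2 > 0. *)
Lemma cone_scale (t : C) (x : 'rV[C]_(2 + (2 + m))) : t != 0 ->
  cone_pair (ReVec x) (ImV x) /\ 0 < cone_det (ReVec x) (ImV x) ->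
  cone_pair (ReVec (t *: x)) (ImV (t *: x)) /\
  0 < cone_det (ReVec (t *: x)) (ImV (t *: x)).
Proof.
move=> t0 [[XY XY0 XX] d0]; pose a := complex.Re t; pose b := complex.Im t.
have n0 : 0 < a * a + b * b.
  rewrite lt0r addr_ge0 -?expr2 ?sqr_ge0 // andbT.
  apply: contra t0; rewrite paddr_eq0 ?sqr_ge0 // !sqrf_eq0 => /andP[/eqP ha /eqP hb].
  by apply/eqP/complex_eq.
have -> : ReVec (t *: x) = a *: ReVec x - b *: ImV x.
  by apply/rowP => i; rewrite !mxE !ReImE.
have -> : ImV (t *: x) = a *: ImV x + b *: ReVec x.
  by apply/rowP => i; rewrite !mxE !ReImE.
split; last first.
  rewrite /cone_det !mxE; rewrite /cone_det !mxE in d0.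
  by have := mulr_gt0 n0 d0; congr (0 < _); ring.
have sy := bilC symGramL (ImV x) (ReVec x).
split; rewrite !bilE sy XY0 -XY; [ring|ring|].
by have := mulr_gt0 n0 XX; congr (0 < _); ring.
Qed.

(** The [f'] coordinate of w(Z) is the real number 1, so the determinant reduces to the coordinate
    of Im Z in [posCone]; isotropy of w(Z) makes both norms equal to (Im Z, Im Z). *)
Lemma cone_wZ (Z : 'rV[C]_(2 + m)) :
  inTube S0 Z <->
  cone_pair (ReVec (wZ S0 Z)) (ImV (wZ S0 Z)) /\
  0 < cone_det (ReVec (wZ S0 Z)) (ImV (wZ S0 Z)).
Proof.
have F1 : ReVec (wZ S0 Z) 0 iF = 1 by rewrite mxE wZ_F.
have F0 : ImV (wZ S0 Z) 0 iF = 0 by rewrite mxE wZ_F.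
have subI : rsubmx (ImV (wZ S0 Z)) = ImV Z by rewrite /ImV -map_rsubmx rsub_wZ.
have I0 : ImV (wZ S0 Z) 0 i0 = ImV Z 0 (lshift m 0) by rewrite -subI [RHS]mxE.
have II : bil L (ImV (wZ S0 Z)) (ImV (wZ S0 Z)) = bil L1 (ImV Z) (ImV Z).
  by rewrite bilLE subI F0 mulr0 mul0r !add0r.
have := wZ_isotropic Z; rewrite (bil_ReIm symGramL) => /[dup].
move=> /(congr1 (@complex.Re R)) + /(congr1 (@complex.Im R)).
rewrite !ReImE /= => hR hI.
have RI : bil L (ReVec (wZ S0 Z)) (ImV (wZ S0 Z)) = 0 by lra.
have RR : bil L (ReVec (wZ S0 Z)) (ReVec (wZ S0 Z)) = bil L1 (ImV Z) (ImV Z).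
  by rewrite -II; lra.
rewrite /cone_det F1 F0 I0 mul1r mul0r subr0 /inTube /posCone; split.
  by case=> h1 h2; split=> //; split=> //; rewrite ?RR ?II.
by case=> -[_ _ h1] h2; split=> //; rewrite -RR.
Qed.

(** This replaces the existential definition by real conditions on (Re x, Im x): a real isometry
    preserves all of them except possibly the sign of the determinant. *)
Lemma inConeDP (x : 'rV[C]_(2 + (2 + m))) : inConeD S0 x <->
  cone_pair (ReVec x) (ImV x) /\ 0 < cone_det (ReVec x) (ImV x).
Proof.
split=> [[t [t0 [Z [/cone_wZ hZ ->]]]]|h]; first exact: cone_scale.
have xF : x 0 iF != 0.
  apply: contraTneq h.2 => xF; rewrite /cone_det !mxE xF /= !mul0r subrr.
  by rewrite ltxx.
have xx : bil L x x = 0.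
  case: h => -[XX XY _] _; rewrite (bil_ReIm symGramL) XX XY subrr.
  by apply: complex_eq; rewrite !ReImE /=; ring.
exists (x 0 iF); split=> //; exists ((x 0 iF)^-1 *: rsubmx x).
split; last exact: isotropic_wZ.
apply/cone_wZ; have tV : (x 0 iF)^-1 != 0 by rewrite invr_eq0.
have := cone_scale tV h; rewrite {2 4 6 8}(isotropic_wZ xx xF) scalerA mulVf //.
by rewrite scale1r.
Qed.

Lemma inTube_cone (t : C) (Z : 'rV[C]_(2 + m)) :
  t != 0 -> inConeD S0 (t *: wZ S0 Z) -> inTube S0 Z.
Proof.
move=> t0 /inConeDP h; have tV : t^-1 != 0 by rewrite invr_eq0.
by apply/cone_wZ; have := cone_scale tV h; rewrite scalerA mulVf // scale1r.
Qed.

Lemma inConeD_wZ (Z : 'rV[C]_(2 + m)) : inTube S0 Z -> inConeD S0 (wZ S0 Z).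
Proof. by move=> hZ; exists 1; rewrite oner_neq0; split=> //; exists Z; rewrite scale1r. Qed.

(** Connectedness argument: t(e, sv) joins the identity to t(e, v) through isometries, and the
    determinant along this path is a polynomial in s without zeros. *)
Lemma cone_eichler (e v : 'rV[R]_(2 + (2 + m))) (q : R) X Y :
  bil L e e = 0 -> bil L e v = 0 -> bil L v v = q + q ->
  cone_pair X Y -> 0 < cone_det X Y ->
  cone_pair (X *m eichler L e v q) (Y *m eichler L e v q) /\
  0 < cone_det (X *m eichler L e v q) (Y *m eichler L e v q).
Proof.
move=> ee ev vv [XY XY0 XX] d0.
pose T s := eichler L e (s *: v) (s * s * q).
have hT s : cone_pair (X *m T s) (Y *m T s).
  have vs : bil L (s *: v) (s *: v) = s * s * q + s * s * q by rewrite !bilE vv; ring.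
  have evs : bil L e (s *: v) = 0 by rewrite bilE ev mulr0.
  by split; rewrite !(bil_eichler symGramL ee evs vs).
pose p (x : 'rV[R]_(2 + (2 + m))) i : {poly R} := (x 0 i)%:P +
  (bil L x e * v 0 i - bil L x v * e 0 i)%:P * 'X - (q * bil L x e * e 0 i)%:P * ('X * 'X).
have pE x i s : (p x i).[s] = (x *m T s) 0 i.
  by rewrite mul_eichler !mxE /p !(hornerD, hornerN, hornerM, hornerC, hornerX) !bilE; ring.
pose d := p X iF * p Y i0 - p Y iF * p X i0.
have dE s : d.[s] = cone_det (X *m T s) (Y *m T s) by rewrite /d hornerD hornerN !hornerM !pE.
have T1 : T 1 = eichler L e v q by rewrite /T scale1r !mul1r.
have T0 : T 0 = 1%:M.
  by rewrite /T /eichler !mul0r scale0r trmx0 !mulmx0 mul0mx scale0r !subr0 addr0.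
rewrite -T1; split=> //; rewrite ltNge; apply/negP => d1.
have [||s _] := @poly_ivt R (- d) 0 1; first exact: ler01.
  by rewrite !hornerN !dE T0 !mulmx1 oppr_le0 oppr_ge0 ltW.
rewrite rootE hornerN oppr_eq0 dE; apply/negP.
exact: cone_det_neq0.
Qed.

Lemma inGammaM g h : inGamma R S0 g -> inGamma R S0 h -> inGamma R S0 (g *m h).
Proof.
case=> -[g' [gg' g'g]] [gG [gD gP]] [[h' [hh' h'h]] [hG [hD hP]]].
split.
  exists (h' *m g'); split.
    by rewrite -mulmxA (mulmxA h) hh' mul1mx.
  by rewrite -mulmxA (mulmxA g') g'g mul1mx.
split; first by rewrite trmx_mul -!mulmxA (mulmxA h) (mulmxA _ h^T) hG mulmxA.
split=> [v hv|v hv]; last by rewrite map_mxM mulmxA; apply/hP/gP.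
have -> : v *m map_mx intr (g *m h) - v =
  (v *m map_mx intr g - v) *m map_mx intr h + (v *m map_mx intr h - v).
  by rewrite map_mxM mulmxBl mulmxA addrA subrK.
by apply: inLatD; [apply/inLatM/gD|apply: hD].
Qed.

Lemma bil_int (K : comNzRingType) k (G : 'M[int]_k) (v w : 'rV[int]_k) :
  bil G (map_mx intr v) (map_mx intr w) = (bil G v w)%:~R :> K.
Proof. exact: (bil_map intr). Qed.

(** For w in the dual lattice (w,e) and (w,v) are integers, so t(e,v) moves w by an integral
    combination of e and v; hence the trivial action on the discriminant group. *)
Lemma inGamma_eichler (e v : 'rV[int]_(2 + (2 + m))) (q : int) :
  bil L e e = 0 -> bil L e v = 0 -> bil L v v = q + q ->
  inGamma R S0 (eichler L e v q).
Proof.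
move=> ee ev vv; split; [|split; [|split]].
- exists (eichler L e (- v) q).
  have h := eichler_mulN symGramL ee ev vv.
  by split; [exact: h|exact: mulmx1C h].
- have := eichler_gram symGramL ee ev vv.
  by congr (_ *m _ *m _ = _); apply/matrixP => i j; rewrite mxE /intr intz.
- move=> w [z hz]; have bw (u : 'rV[int]_(2 + (2 + m))) :
      exists c : int, bil L w (map_mx intr u) = c%:~R.
    exists ((z *m u^T) 0 0); rewrite /bil hz map_trmx -map_mxM mxE.
    by [].
  have [a ha] := bw e; have [b hb] := bw v.
  exists (a *: v - b *: e - (q * a) *: e).
  rewrite map_eichler mul_eichler ha hb !map_mxB !map_mxZ.
  by apply/rowP => j; rewrite !mxE /intr !rmorphM /=; ring.
move=> x /inConeDP[hx dx]; apply/inConeDP.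
have -> : map_mx intr (eichler L e v q) = map_mx toC (map_mx intr (eichler L e v q)).
  exact: map_intC.
case: (ReIm_mulmx x (map_mx intr (eichler L e v q))) => -> ->.
rewrite map_eichler; apply: cone_eichler => //.
- by rewrite bil_int ee.
- by rewrite bil_int ev.
- by rewrite bil_int vv /intr rmorphD.
Qed.

End Lattice.

(** * The Eichler criterion *)

Section EichlerCriterion.
Variables (k : nat) (G : 'M[int]_k) (symG : G^T = G).
Hypothesis evenG : forall z : 'rV[int]_k, exists q : int, bil G z z = q + q.
Variables e1 f1 e2 f2 : 'rV[int]_k.
Hypotheses (e1e1 : bil G e1 e1 = 0) (f1f1 : bil G f1 f1 = 0)
  (e2e2 : bil G e2 e2 = 0) (f2f2 : bil G f2 f2 = 0)
  (e1f1 : bil G e1 f1 = 1) (e2f2 : bil G e2 f2 = 1)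
  (e1e2 : bil G e1 e2 = 0) (e1f2 : bil G e1 f2 = 0)
  (f1e2 : bil G f1 e2 = 0) (f1f2 : bil G f1 f2 = 0).
Variable Gam : 'M[int]_k -> Prop.
Hypothesis Gam_mul : forall g h, Gam g -> Gam h -> Gam (g *m h).
Hypothesis Gam_bil : forall g x y, Gam g -> bil G (x *m g) (y *m g) = bil G x y.
Hypothesis Gam_eichler : forall e v q,
  bil G e e = 0 -> bil G e v = 0 -> bil G v v = q + q -> Gam (eichler G e v q).

Let f1e1 : bil G f1 e1 = 1. Proof. by rewrite bilC. Qed.
Let f2e2 : bil G f2 e2 = 1. Proof. by rewrite bilC. Qed.
Let e2e1 : bil G e2 e1 = 0. Proof. by rewrite bilC. Qed.
Let f2e1 : bil G f2 e1 = 0. Proof. by rewrite bilC. Qed.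
Let e2f1 : bil G e2 f1 = 0. Proof. by rewrite bilC. Qed.
Let f2f1 : bil G f2 f1 = 0. Proof. by rewrite bilC. Qed.
Let hypE := (e1e1, f1f1, e2e2, f2f2, e1f1, e2f2, e1e2, e1f2, f1e2, f1f2,
             f1e1, f2e2, e2e1, f2e1, e2f1, f2f1).

Definition same_orbit (u u' : 'rV[int]_k) := exists2 g, Gam g & u *m g = u'.

Lemma same_orbit_trans u v w : same_orbit u v -> same_orbit v w -> same_orbit u w.
Proof. by move=> [g Gg <-] [h Gh <-]; exists (g *m h); rewrite ?mulmxA; auto. Qed.

Lemma same_orbit_eichler u e v q u' :
  bil G e e = 0 -> bil G e v = 0 -> bil G v v = q + q ->
  u' = u + bil G u e *: v - bil G u v *: e - (q * bil G u e) *: e ->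
  same_orbit u u'.
Proof. by move=> ? ? ? ->; exists (eichler G e v q); rewrite ?mul_eichler; auto. Qed.

Definition unimodular (u : 'rV[int]_k) := bil G u u = 0 /\ exists z, bil G u z = 1.

Lemma unimodular_orbit u v : same_orbit u v -> unimodular u -> unimodular v.
Proof.
move=> [g Gg <-] [uu [z uz]]; split; first by rewrite Gam_bil.
by exists (z *m g); rewrite Gam_bil.
Qed.

(** A step of Euclid's algorithm on b = (u,e1) and (u,q): a transvection along e1 reduces (u,q) to
    its remainder r modulo b and keeps b, then one along f1 subtracts a multiple of r from b. *)
Lemma orbit_descent u p q : (p, q) = (e2, f2) \/ (p, q) = (f2, e2) ->
  bil G u e1 != 0 -> ~~ (bil G u e1 %| bil G u q)%Z ->
  exists2 u', same_orbit u u' & (0 < `|bil G u' e1| < `|bil G u e1|).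
Proof.
move=> pq b0 bc; set b := bil G u e1 in b0 bc *.
have [[pp qq pq1] [e1p e1q f1q]] :
    [/\ bil G p p = 0, bil G q q = 0 & bil G p q = 1] /\
    [/\ bil G e1 p = 0, bil G e1 q = 0 & bil G f1 q = 0].
  by case: pq => -[-> ->]; rewrite !hypE.
pose r := (bil G u q %% b)%Z; pose j := (bil G u q %/ b)%Z.
have rE : bil G u q = j * b + r by rewrite [LHS](divz_eq _ b).
have r0 : 0 < r.
  by rewrite lt0r modz_ge0 // andbT; apply: contra bc => /eqP h; apply/dvdz_mod0P.
have rb : r < `|b| by rewrite ltz_mod.
pose u1 := u - (j * b) *: p + (j * bil G u p) *: e1.
have o1 : same_orbit u u1.
  apply: (same_orbit_eichler (e := e1) (v := - j *: p) (q := 0)) => //.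
  - by rewrite !bilE e1p mulr0.
  - by rewrite !bilE pp !mulr0.
  by rewrite /u1 !bilE -/b; apply/rowP => l; rewrite !mxE; ring.
have u1e : bil G u1 e1 = b by rewrite !bilE (bilC symG p) e1p e1e1 -/b; ring.
have u1q : bil G u1 q = r by rewrite !bilE pq1 e1q rE; ring.
(* Dividing b - 1 instead of b puts b - i r in [1, r], so the new pairing with e1 is smaller but
   never zero. *)
pose i := ((b - 1) %/ r)%Z.
have iE : b - 1 = i * r + ((b - 1) %% r)%Z by rewrite [LHS](divz_eq _ r).
have i0 : 0 <= ((b - 1) %% r)%Z by rewrite modz_ge0 // gt_eqF.
have ir : ((b - 1) %% r)%Z < r by rewrite ltz_pmod.
exists (u1 + (bil G u1 f1 * i) *: q - (i * r) *: f1).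
  apply: (same_orbit_trans o1).
  apply: (same_orbit_eichler (e := f1) (v := i *: q) (q := 0)) => //.
  - by rewrite !bilE f1q mulr0.
  - by rewrite !bilE qq !mulr0.
  by rewrite bilZr u1q; apply/rowP => l; rewrite !mxE; ring.
rewrite bilDl bilNl bilDl !bilZl u1e (bilC symG q) e1q f1e1.
have -> : b + bil G u1 f1 * i * 0 - i * r * 1 = ((b - 1) %% r)%Z + 1.
  by rewrite mulr0 mulr1 addr0; lia.
lia.
Qed.

Lemma orbit_end u : bil G u u = 0 -> bil G u e1 * bil G u e1 = 1 -> same_orbit u e1.
Proof.
move=> uu; set b := bil G u e1 => bb; pose a := bil G u f1.
have o1 : same_orbit u (b *: f1).
  (* The component of u orthogonal to e1 and f1; t(e1, -b w) removes it because b^2 = 1, and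
     isotropy then removes the e1 component. *)
  pose w := u - a *: e1 - b *: f1.
  have e1w : bil G e1 w = 0 by rewrite !bilE !hypE (bilC symG e1 u) -/b; ring.
  have ww : bil G w w = - (a * b) - a * b.
    by rewrite !bilE !hypE uu (bilC symG e1 u) (bilC symG f1 u) -/b -/a; ring.
  have uw : bil G u w = - (a * b) - a * b by rewrite !bilE uu -/b -/a; ring.
  apply: (same_orbit_eichler (e := e1) (v := - b *: w) (q := - (a * b))) => //.
  - by rewrite bilZr e1w mulr0.
  - by rewrite bilZr bilZl ww -[RHS]mul1r -bb; ring.
  rewrite bilZr uw -/b; apply/rowP => l; rewrite !mxE.
  transitivity (u 0 l - (b * b) * (u 0 l - a * e1 0 l - b * f1 0 l)
     - (b * b) * (a * e1 0 l)); last by ring.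
  by rewrite bb; ring.
(* Neither a sign change nor the exchange of e1 and f1 is given in [Gam]; the detour through the
   second hyperbolic plane turns b f1 into e1 and absorbs the sign. *)
have o2 : same_orbit (b *: f1) (b *: f1 + b *: e2).
  apply: (same_orbit_eichler (e := e1) (v := e2) (q := 0)); rewrite ?bilE ?hypE //.
  by apply/rowP => l; rewrite !mxE; ring.
have o3 : same_orbit (b *: f1 + b *: e2) (b *: e2).
  apply: (same_orbit_eichler (e := f2) (v := - f1) (q := 0)); rewrite ?bilE ?hypE //;
    first [ring | by apply/rowP => l; rewrite !mxE; ring].
have o4 : same_orbit (b *: e2) (b *: e2 + e1).
  apply: (same_orbit_eichler (e := f2) (v := b *: e1) (q := 0));
    rewrite ?bilE ?hypE //; first [ring | apply/rowP => l; rewrite !mxE].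
  by transitivity (b * e2 0 l + (b * b) * e1 0 l); [rewrite bb|]; ring.
have o5 : same_orbit (b *: e2 + e1) e1.
  apply: (same_orbit_eichler (e := f1) (v := - (b *: e2)) (q := 0));
    rewrite ?bilE ?hypE //; first [ring | by apply/rowP => l; rewrite !mxE; ring].
apply: (same_orbit_trans o1); apply: (same_orbit_trans o2); apply: (same_orbit_trans o3).
exact: (same_orbit_trans o4).
Qed.

Lemma orbit_neq0 u : unimodular u -> exists2 u', same_orbit u u' & bil G u' e1 != 0.
Proof.
move=> [_ [z uz]].
have step2 p q u1 : (p, q) = (e2, f2) \/ (p, q) = (f2, e2) -> bil G u1 e1 = 0 ->
    bil G u1 q != 0 -> exists2 u', same_orbit u1 u' & bil G u' e1 != 0.
  move=> pq b0 c0; exists (u1 + bil G u1 f1 *: q - bil G u1 q *: f1).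
    apply: (same_orbit_eichler (e := f1) (v := q) (q := 0)) => //;
      try by case: pq => -[_ ->]; rewrite hypE.
    by rewrite mul0r scale0r subr0.
  have q0 : bil G q e1 = 0 by case: pq => -[_ ->]; rewrite hypE.
  by rewrite !bilE b0 q0 hypE mulr0 mulr1 !add0r oppr_eq0.
have [b0|b0] := eqVneq (bil G u e1) 0; last first.
  by exists u => //; exists (eichler G e1 0 0);
    [apply: Gam_eichler; rewrite ?bilE|rewrite mul_eichler !bilE; apply/rowP => l;
     rewrite !mxE; ring].
have [c0|c0] := eqVneq (bil G u f2) 0; last by apply: (step2 e2 f2); auto.
have [d0|d0] := eqVneq (bil G u e2) 0; last by apply: (step2 f2 e2); auto.
have o1 : same_orbit u (u - e2).
  (* The correction by f2 makes w orthogonal to e2 and keeps (u,w) = 1, since (u,f2) = 0. The move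
     to u - e2 creates the pairing -1 with f2. *)
  pose w := z - bil G z e2 *: f2; have [q qE] := evenG w.
  apply: (same_orbit_eichler (e := e2) (v := w) (q := q)) => //.
    by rewrite !bilE hypE mulr1 (bilC symG z) subrr.
  rewrite !bilE uz c0 d0; apply/rowP => l; rewrite !mxE; ring.
have [||u' o2 h] := step2 e2 f2 (u - e2) (or_introl erefl).
- by rewrite !bilE b0 hypE subrr.
- by rewrite !bilE c0 hypE.
by exists u' => //; apply: same_orbit_trans o2.
Qed.

(** Induction on |(u,e1)|: the descent applies as soon as (u,e1) fails to divide the pairing with e2
    or f2, possibly after another move inside the orbit. *)
Lemma eichler_criterion u : unimodular u -> same_orbit u e1.
Proof.
move=> /[dup] Pu /orbit_neq0[u' o1 b0].
apply: (same_orbit_trans o1); move: (unimodular_orbit o1 Pu) b0 => {o1 Pu}.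
have [n] := ubnP `|bil G u' e1|%N; elim: n u' => [//|n IH] {}u un Pu b0.
have red p q u1 : (p, q) = (e2, f2) \/ (p, q) = (f2, e2) -> same_orbit u u1 ->
    bil G u1 e1 = bil G u e1 -> ~~ (bil G u e1 %| bil G u1 q)%Z -> same_orbit u e1.
  move=> pq o1 bE nd.
  have [||u2 o2 /andP[h1 h2]] := @orbit_descent u1 p q pq; rewrite ?bE //.
  have o12 := same_orbit_trans o1 o2.
  apply: (same_orbit_trans o12); apply: IH.
  - by move: h2; rewrite bE; move: un; lia.
  - exact: unimodular_orbit Pu.
  - by rewrite -normr_gt0.
have ou : same_orbit u u.
  exists (eichler G e1 0 0); first by apply: Gam_eichler; rewrite ?bilE.
  by rewrite mul_eichler !bilE; apply/rowP => l; rewrite !mxE; ring.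
have [/dvdzP[c cE]|] := boolP (bil G u e1 %| bil G u f2)%Z; last by apply: red; auto.
have [/dvdzP[d dE]|] := boolP (bil G u e1 %| bil G u e2)%Z; last by apply: (red f2 e2); auto.
(* When b divides both pairings, this transvection makes them zero. Unimodularity then allows
   subtracting e2, which gives pairing -1 with f2: either b does not divide -1 and the descent
   continues, or b = 1 or -1. *)
pose b := bil G u e1; pose w := - c *: e2 - d *: f2.
pose u2 := u + b *: w - bil G u w *: e1 - (c * d * b) *: e1.
have o2 : same_orbit u u2.
  apply: (same_orbit_eichler (e := e1) (v := w) (q := c * d)) => //;
    rewrite !bilE !hypE; ring.
have u2e1 : bil G u2 e1 = b by rewrite !bilE !hypE -/b; ring.
have u2e2 : bil G u2 e2 = 0 by rewrite !bilE !hypE dE -/b; ring.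
have u2f2 : bil G u2 f2 = 0 by rewrite !bilE !hypE cE -/b; ring.
have [uu2 [z uz]] := unimodular_orbit o2 Pu.
have o3 : same_orbit u2 (u2 - e2).
  pose y := z - bil G z e2 *: f2; have [q qE] := evenG y.
  apply: (same_orbit_eichler (e := e2) (v := y) (q := q)) => //.
    by rewrite !bilE hypE mulr1 (bilC symG z) subrr.
  have -> : bil G u2 y = 1 by rewrite bilDr bilNr bilZr uz u2f2; ring.
  rewrite u2e2; apply/rowP => l; rewrite !mxE; ring.
have := red e2 f2 _ (or_introl erefl) (same_orbit_trans o2 o3).
rewrite bilDl bilNl u2e1 hypE subr0 => /(_ erefl).
rewrite bilDl bilNl u2f2 hypE sub0r => h.
have [b1|/h //] := boolP (bil G u e1 %| -1)%Z.
apply: (same_orbit_trans o2); apply: orbit_end => //; rewrite u2e1 /b.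
by move: b1; rewrite dvdzE /= dvdn1 => /eqP; nia.
Qed.

End EichlerCriterion.

(** * Unimodular vectors in rational isotropic planes *)

Lemma common_denominator k l (A : 'M[rat]_(k, l)) :
  exists2 c : int, c != 0 & exists M : 'M[int]_(k, l), map_mx intr M = c%:~R *: A.
Proof.
exists (\prod_(p : 'I_k * 'I_l) denq (A p.1 p.2)).
  by apply/prodf_neq0 => p _; rewrite denq_neq0.
exists (\matrix_(i, j) (numq (A i j) *
   \prod_(p : 'I_k * 'I_l | p != (i, j)) denq (A p.1 p.2))).
apply/matrixP => i j; rewrite !mxE [in RHS](bigD1 (i, j)) //= /intr !intrM.
by rewrite mulrAC [(denq _)%:~R * _]mulrC -numqE.
Qed.

(** The pair (x,y) must work before the multiple c is known. With (a',b') = (a,b)/gcd, the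
    functional (-b',a') kills (a,b), and Bezout gives (x,y) where it takes the value 1. *)
Lemma primitive_mod_cyclic (a b : int) :
  exists x y : int, forall c, exists s t, s * (x - c * a) + t * (y - c * b) = 1.
Proof.
have [g0|g0] := eqVneq (gcdz a b) 0.
  move/eqP: g0; rewrite gcdz_eq0 => /andP[/eqP-> /eqP->].
  by exists 1, 0 => c; exists 1, 0; ring.
have /dvdzP[a' aE] := dvdz_gcdl a b; have /dvdzP[b' bE] := dvdz_gcdr a b.
have [s0 [t0 st]] := Bezoutz a b.
have e1 : s0 * a' + t0 * b' = 1.
  by apply: (mulIf g0); rewrite mul1r mulrDl -!mulrA -aE -bE st.
exists (- t0), s0 => c; exists (- b'), a'.
have e2 : b' * a = a' * b by rewrite {1}aE [RHS]mulrC {2}bE; ring.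
rewrite [LHS](_ : _ = (s0 * a' + t0 * b') + c * (b' * a - a' * b)); last by ring.
by rewrite e1 e2 subrr mulr0 addr0.
Qed.

(* A totally isotropic rational plane whose intersection with the dual lattice is
   cyclic modulo the lattice contains a lattice vector [u] with [(u, L) = Z]: Smith's
   normal form gives a basis of the intersection, and [cyclic] allows one to
   correct a primitive vector of the intersection by a multiple of the generator. *)
Lemma unimodular_in_plane k (G : 'M[int]_k) (N : 'M[rat]_(2, k)) :
  (1 < k)%N -> G^T = G -> (forall z : 'rV[int]_k, exists q : int, bil G z z = q + q) ->
  map_mx intr G \in (@unitmx rat k) ->
  isotropic_subgroups_cyclic G -> row_free N ->
  (forall r s : 'rV[rat]_2, bil G (r *m N) (s *m N) = 0) ->
  exists (u z : 'rV[int]_k) (r : 'rV[rat]_2), map_mx intr u = r *m N /\ bil G u z = 1.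
Proof.
move=> k1 symG evG uG cyc freeN isoN; set GQ := map_mx intr G in uG.
have [c c0 [M ME]] := common_denominator (N *m GQ).
(* The left factor and the invariant factors are collected in [E], invertible over the rationals;
   what remains, [P *m B], is the first two rows of a unimodular matrix. *)
have [A uA [B uB [d _ MD]]] := int_Smith_normal_form M.
pose E := A *m diag_mx (\row_(i < 2) d`_i).
pose P : 'M[int]_(2, k) := pid_mx 2.
have PP : P *m pid_mx 2 = 1%:M.
  by rewrite mul_pid_mx minnn (minn_idPr k1) pid_mx_1.
have {MD} MD : M = E *m (P *m B).
  rewrite MD /E -!mulmxA; congr (_ *m _); rewrite !mulmxA; congr (_ *m _).
  apply/matrixP => i j; rewrite mul_diag_mx !mxE ltn_ord andbT.
  by case: (_ == _); rewrite ?mulr1n ?mulr0n ?mulr1 ?mulr0.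
clearbody E; have c0' : (c%:~R : rat) != 0 by rewrite intr_eq0.
have uE : map_mx intr E \in (@unitmx rat 2).
  rewrite -row_free_unit /row_free eqn_leq rank_leq_row /=.
  have rM : \rank (map_mx intr M : 'M[rat]_(2, k)) = 2%N.
    rewrite ME mxrank_scale_nz // mxrankMfree ?row_free_unit //.
    exact/eqP.
  by rewrite -[leqLHS]rM MD map_mxM mxrankM_maxl.
(* In this basis of the plane, r N' lies in the dual lattice exactly when r is integral, because N'
   G has an integral right inverse. *)
pose N' := c%:~R *: invmx (map_mx intr E) *m N.
have N'G : N' *m GQ = map_mx intr (P *m B).
  rewrite /N' -!scalemxAl -mulmxA scalemxAr -ME MD map_mxM mulmxA mulVmx //.
  by rewrite mul1mx.
have dualP (r : 'rV[rat]_2) : inDual G (r *m N') <-> inLat r.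
  split=> [h|h]; last by rewrite /inDual -(mulmxA r) N'G; apply: inLatM.
  have := inLatM (invmx B *m (pid_mx 2 : 'M[int]_(k, 2))) h.
  rewrite -(mulmxA r) N'G -mulmxA -map_mxM.
  by rewrite -(mulmxA P) (mulmxA B) mulmxV // mul1mx PP map_mx1 mulmx1.
pose H (v : 'rV[rat]_k) := inDual G v /\ exists r l, inLat l /\ v = r *m N' + l.
have latD (v : 'rV[rat]_k) : inLat v -> inDual G v by exact: inLatM.
have dualD (v w : 'rV[rat]_k) : inDual G v -> inDual G w -> inDual G (v - w).
  by rewrite /inDual mulmxBl => hv hw; apply/inLatD/inLatN.
have [||||g [[gD [rg [lg [lgL gE]]]] gen]] := cyc H.
- by move=> v hv; split; [exact: latD|exists 0, v; rewrite mul0mx add0r].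
- by move=> v [].
- move=> v w [vD [rv [lv [lvL vE]]]] [wD [rw [lw [lwL wE]]]].
  split; first exact: dualD.
  exists (rv - rw), (lv - lw); split; first exact/inLatD/inLatN.
  by rewrite vE wE mulmxBl opprD addrACA.
(* The plane is isotropic, so (v,v) = 2 (r N', l) + (l,l), where the pairing of a dual vector with a
   lattice vector is an integer and (l,l) is even. *)
- move=> v [vD [r [l [[l0 lE] vE]]]].
  have rD : inDual G (r *m N').
    by rewrite -(addrK l (_ *m _)) -vE; apply: dualD => //; apply: latD; exists l0.
  case: rD => y yE; have [q qE] := evG l0.
  exists ((y *m l0^T) 0 0 + q); rewrite vE !bilE.
  have -> : bil G (r *m N') (r *m N') = 0.
    by rewrite /N' !mulmxA; exact: isoN.
  have rl : bil G (r *m N') l = ((y *m l0^T) 0 0)%:~R.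
    by rewrite /bil yE lE map_trmx -map_mxM mxE.
  rewrite (bilC symG l) rl lE bil_int qE /intr !rmorphM !rmorphD /=; ring.
have [e0 e0E] : inLat rg.
  by apply/dualP; rewrite -(addrK lg (_ *m _)) -gE; apply: dualD => //; apply: latD.
(* In the basis N' the generator has integral coordinates e0 modulo L. Whatever multiple a cyclicity
   assigns to w, the vector w - a e0 stays primitive and gives a lattice vector. *)
have [x [y xy]] := primitive_mod_cyclic (e0 0 0) (e0 0 1).
pose w := \row_(i < 2) if i == 0 then x else y.
have wH : H (map_mx intr w *m N').
  split; first by apply/dualP; exists w.
  by exists (map_mx intr w), 0; rewrite addr0; split=> //; exists 0; rewrite map_mx0.
have [a] := gen _ wH.
have {}gE : g *~ a = (map_mx intr (a *: e0) *m N') + lg *~ a.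
  by rewrite gE e0E mulrzDl map_mxZ -scalemxAl -scaler_int.
rewrite gE opprD addrA -mulmxBl -map_mxB => /inLatD/(_ _)h.
have [u uE'] : inLat (map_mx intr (w - a *: e0) *m N').
  rewrite -[X in inLat X](subrK (lg *~ a)); apply: h.
  case: lgL => l0 ->; exists (a *: l0).
  by rewrite map_mxZ -scaler_int.
have [s [t st]] := xy a; pose v := \row_(i < 2) if i == 0 then s else t.
exists u, (v *m (invmx B *m (pid_mx 2 : 'M[int]_(k, 2)))^T),
  (map_mx intr (w - a *: e0) *m (c%:~R *: invmx (map_mx intr E))).
split; first by rewrite -uE' /N' mulmxA.
apply: (@intr_inj rat); rewrite -bil_int /bil -uE' -(mulmxA (map_mx _ (w - _))) N'G map_trmx.
rewrite trmx_mul trmxK -!map_mxM mxE; congr (_%:~R).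
rewrite !mulmxA -(mulmxA _ B) mulmxV // mulmx1 -(mulmxA _ P) PP mulmx1.
rewrite mxE big_ord_recl big_ord1 !mxE /= -[RHS]st.
have -> : lift (0 : 'I_2) (0 : 'I_1) = 1 :> 'I_2 by apply/val_inj.
by ring.
Qed.

(** * Moving boundary components to the standard cusp *)

Section CuspTransfer.
Variables (R : realType) (m : nat) (S0 : 'M[int]_m).
Hypothesis S0P : even_negdef_gram R S0.
Local Notation C := R[i].
Local Notation toC := (real_complex R).
Local Notation L1 := (Gram1 S0).
Local Notation L := (GramL S0).
Local Notation iE := (lshift (2 + m) (0 : 'I_2)).
Local Notation iF := (lshift (2 + m) (1 : 'I_2)).
Local Notation i0 := (rshift 2 (lshift m (0 : 'I_2))).
Local Notation i1 := (rshift 2 (lshift m (1 : 'I_2))).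

Lemma unit_blockU k (G : 'M[int]_k) : map_mx intr G \in (@unitmx rat k) ->
  map_mx intr (block_mx GramU 0 0 G) \in (@unitmx rat (2 + k)).
Proof.
rewrite map_block_mx !map_mx0 !unitmxE det_ublock unitrM => ->; rewrite andbT -unitmxE.
suff /mulmx1_unit[] : map_mx intr GramU *m map_mx intr GramU = 1%:M :> 'M[rat]_2 by [].
rewrite -map_mxM -[RHS](map_mx1 intr); congr map_mx; apply/matrixP => i j.
rewrite !mxE big_ord_recl big_ord1 !mxE.
by case: i j => [[|[|//]] ?] [[|[|//]] ?].
Qed.

Lemma unit_S0 : map_mx intr S0 \in (@unitmx rat m).
Proof.
rewrite -row_free_unit; apply: inj_row_free => v v0.
suff : map_mx (ratr : rat -> R) v = 0.
  by move=> /rowP h; apply/rowP => i; have := h i; rewrite !mxE => /eqP; rewrite fmorph_eq0 => /eqP.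
by apply: (negdef_eq0 S0P); rewrite bil_map /bil v0 mul0mx mxE rmorph0.
Qed.

Lemma unit_L1 : map_mx intr L1 \in (@unitmx rat (2 + m)).
Proof. exact/unit_blockU/unit_S0. Qed.

Lemma unit_L : map_mx intr L \in (@unitmx rat (2 + (2 + m))).
Proof. exact/unit_blockU/unit_L1. Qed.

Lemma orbit_standard_cusp (u z : 'rV[int]_(2 + (2 + m))) :
  bil L u u = 0 -> bil L u z = 1 ->
  exists2 g, inGamma R S0 g & u *m g = delta_mx 0 iE.
Proof.
move=> uu uz; have symL := symGramL S0P.
have bd i j : bil L (delta_mx 0 i) (delta_mx 0 j) = L i j.
  by rewrite /bil mx_delta mxE /intr intz.
have [] := @eichler_criterion _ L symL (even_L S0P) (delta_mx 0 iE) (delta_mx 0 iF)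
  (delta_mx 0 i0) (delta_mx 0 i1) _ _ _ _ _ _ _ _ _ _ (inGamma R S0) _ _ _ u _.
all: rewrite ?bd /GramL /Gram1 ?(block_mxEul, block_mxEur, block_mxEdr) ?mxE //.
- exact: inGammaM.
- move=> g x y [_ [gG _]]; apply: bil_mul.
  rewrite [map_mx _ _](_ : _ = L) //.
  by apply/matrixP => i j; rewrite mxE /intr intz.
- exact: inGamma_eichler.
- by split=> //; exists z.
by move=> g; exists g.
Qed.

(** Isotropy of Y removes the term in s^2, so w moves on a straight line whose direction lies in the
    plane of [e'] and Y. *)
Lemma wZ_shift (Z : 'rV[C]_(2 + m)) (Y : 'rV[C]_(2 + m)) (s : C) : bil L1 Y Y = 0 ->
  wZ S0 (Z + s *: Y) =
  wZ S0 Z + s *: (row_mx 0 Y - bil L1 Z Y *: delta_mx 0 iE).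
Proof.
move=> YY; apply: rowU_eq; last first.
- rewrite !rsubE_lin !rsub_wZ row_mxKr.
  rewrite [rsubmx (delta_mx _ _)](_ : _ = 0) ?scaler0 ?subr0 //.
  by apply/rowP => i; rewrite !mxE.
- by rewrite !rowE_lin !wZ_F row_mxEl !mxE /= mulr0 subr0 mulr0 addr0.
rewrite !rowE_lin !wZ_E row_mxEl !mxE !eqxx /= !bilE YY (bilC (symGram1 S0P) Y).
by field.
Qed.

Hypothesis cyc : isotropic_subgroups_cyclic L.

(* The boundary component of the plane spanned by [e' h] and [Y1 h] is moved by Gamma to
   one adjacent to the standard cusp; the direction [Y1] becomes the
   rational isotropic direction [Y2]. *)
Lemma boundary_transfer (h : 'M[rat]_(2 + (2 + m))) (Y1 : 'rV[rat]_(2 + m)) :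
  inOplusQ R S0 h -> Y1 != 0 -> bil L1 Y1 Y1 = 0 ->
  exists g (Y2 : 'rV[rat]_(2 + m)), [/\ inGamma R S0 g, Y2 != 0, bil L1 Y2 Y2 = 0 &
    forall Z : 'rV[C]_(2 + m), inTube S0 Z -> exists (J : C) Z', [/\ J != 0, inTube S0 Z' &
      forall s : C, wZ S0 (Z + s *: map_mx (@ratC R) Y1) *m map_mx (@ratC R) h *m map_mx intr g
        = J *: wZ S0 (Z' + s *: map_mx (@ratC R) Y2)]].
Proof.
move=> [uh [hG hD]] Y10 YY; have symL := symGramL S0P.
pose e : 'rV[rat]_(2 + (2 + m)) := delta_mx 0 iE.
pose y : 'rV[rat]_(2 + (2 + m)) := row_mx 0 Y1.
pose N := \matrix_(i < 2) (if i == 0 then e else y).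
have NE (r : 'rV[rat]_2) : r *m N = r 0 0 *: e + r 0 1 *: y.
  rewrite mulmx_sum_row big_ord_recl big_ord1 !rowK /=.
  by congr (_ + r 0 _ *: _); apply/val_inj.
have yE : y 0 iE = 0 by rewrite /y row_mxEl mxE.
have yF : y 0 iF = 0 by rewrite /y row_mxEl mxE.
have yr : rsubmx y = Y1 by rewrite /y row_mxKr.
have eE : e 0 iE = 1 by rewrite /e mxE !eqxx.
have eF : e 0 iF = 0 by rewrite /e mxE.
have er : rsubmx e = 0 by apply/rowP => i; rewrite !mxE.
have ee : bil L e e = 0 by rewrite bilLE eF er bil0l; ring.
have ey : bil L e y = 0 by rewrite bilLE eF yF er bil0l; ring.
have yy : bil L y y = 0 by rewrite bilLE yE yr YY; ring.
have isoN (r s : 'rV[rat]_2) : bil L (r *m N) (s *m N) = 0.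
  by rewrite !NE !bilE (bilC symL y e) ee ey yy; ring.
have freeN : row_free N.
  apply: inj_row_free => r /[dup] rN; rewrite NE => /rowP/(_ iE).
  rewrite !rowE_lin yE eE mulr1 mulr0 addr0 mxE => r0.
  move: rN; rewrite NE r0 scale0r add0r => /(congr1 rsubmx).
  rewrite linearZ /= yr linear0 => /eqP; rewrite scaler_eq0 (negPf Y10) orbF => /eqP r1.
  apply/rowP => i; rewrite mxE.
  have [->//|->//] : i = 0 \/ i = 1.
  by case: i => [[|[|//]] ?]; [left|right]; apply/val_inj.
have freeNh (A : 'M[rat]_(2 + (2 + m))) : A \in unitmx -> row_free (N *m A).
  by move=> uA; rewrite /row_free mxrankMfree ?row_free_unit.
have isoNh (r s : 'rV[rat]_2) : bil L (r *m (N *m h)) (s *m (N *m h)) = 0.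
  by rewrite !mulmxA bil_mul.
have [//|u [z [r [urN uz]]]] :=
  unimodular_in_plane _ symL (even_L S0P) unit_L cyc (freeNh _ uh) isoNh.
have uu : bil L u u = 0 by apply: (@intr_inj rat); rewrite -bil_int urN isoNh.
have [g gG ug] := orbit_standard_cusp uu uz.
pose h' := h *m map_mx intr g.
have gGQ : map_mx intr g *m map_mx intr L *m (map_mx intr g)^T = map_mx intr L :> 'M[rat]_(_).
  by case: gG => _ [gG _]; rewrite map_trmx -!map_mxM gG.
have h'G : h' *m map_mx intr L *m h'^T = map_mx intr L.
  by rewrite /h' trmx_mul -!mulmxA (mulmxA (map_mx _ g)) (mulmxA (map_mx _ g *m _)) gGQ mulmxA.
have uh' : h' \in unitmx.
  rewrite /h' unitmx_mul uh /=; case: gG => [[g' [_ gg']] _].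
  have /mulmx1_unit[] // : map_mx intr g *m map_mx intr g' = 1%:M :> 'M[rat]_(_).
  by rewrite -map_mxM (mulmx1C gg') map_mx1.
have rNh : r *m N *m h' = e.
  rewrite /h' !mulmxA -(mulmxA r) -urN -map_mxM ug.
  by apply/rowP => i; rewrite !mxE; case: (_ && _).
have pF (x : 'rV[rat]_(2 + (2 + m))) : bil L x e = x 0 iF.
  by rewrite bilLE eE eF er bil0r; ring.
(* The moved plane is isotropic and contains [e'], hence is orthogonal to [e']. *)
have NhF (s : 'rV[rat]_2) : (s *m N *m h') 0 iF = 0.
  by rewrite -pF -rNh bil_mul // isoN.
pose A := rsubmx (e *m h'); pose B := rsubmx (y *m h').
have AB : r 0 0 *: A + r 0 1 *: B = 0.
  by rewrite -er -rNh NE mulmxDl -!scalemxAl linearD !linearZ.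
have eN : delta_mx 0 0 *m N = e by rewrite -rowE rowK.
have yN : delta_mx 0 1 *m N = y by rewrite -rowE rowK.
have ehF : (e *m h') 0 iF = 0 by rewrite -eN NhF.
have yhF : (y *m h') 0 iF = 0 by rewrite -yN NhF.
(* A and B satisfy a nontrivial linear relation, so both are multiples of one vector. The scaling is
   chosen so that B - tau A = (r_0 + r_1 tau) Y2, which is t Y2 below; thus the parameter s is
   preserved. *)
have [Y2 [BE AE]] : exists Y2, B = r 0 0 *: Y2 /\ A = - r 0 1 *: Y2.
  have [r0|r0] := eqVneq (r 0 0) 0; last first.
    exists ((r 0 0)^-1 *: B); rewrite !scalerA mulfV // scale1r; split=> //.
    apply: (scalerI r0); rewrite scalerA mulrCA mulfV // mulr1.
    by apply/eqP; rewrite scaleNr -addr_eq0 AB.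
  have r1 : r 0 1 != 0.
    apply/eqP => r1; move: rNh; rewrite NE r0 r1 !scale0r addr0 mul0mx => /rowP/(_ iE).
    by rewrite eE mxE => /eqP; rewrite eq_sym oner_eq0.
  exists (- (r 0 1)^-1 *: A); rewrite r0 scale0r scalerA mulrNN mulfV // scale1r.
  split=> //; move: AB; rewrite r0 scale0r add0r => /eqP.
  by rewrite scaler_eq0 (negPf r1) => /eqP.
have row0 (x : 'rV[rat]_(2 + (2 + m))) : x 0 iF = 0 -> rsubmx x = 0 -> x = x 0 iE *: e.
  move=> xF xr; apply: rowU_eq; rewrite ?rowE_lin ?eE ?eF ?mulr1 ?mulr0 //.
  by rewrite xr linearZ /= er scaler0.
exists g, Y2; split=> //.
- apply/eqP => Y20; move: BE AE; rewrite Y20 !scaler0 => B0 A0.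
  have inj (v : 'rV[rat]_2) : v *m (N *m h') = 0 -> v = 0.
    by move=> v0; apply: (row_free_inj (freeNh _ uh')); rewrite v0 mul0mx.
  have ea := row0 (e *m h') ehF A0; have ya := row0 (y *m h') yhF B0.
  set a := (e *m h') 0 iE in ea; set b := (y *m h') 0 iE in ya.
  have /inj : (b *: delta_mx 0 0 - a *: delta_mx 0 1 : 'rV[rat]_2) *m (N *m h') = 0.
    by rewrite mulmxA !mulmxBl -!scalemxAl eN yN ea ya !scalerA mulrC subrr.
  move=> /rowP /[dup] /(_ 0) + /(_ 1); rewrite !mxE /= !mulr1 !mulr0 subr0 sub0r.
  move=> b0 _; move: ya; rewrite b0 scale0r -yN -mulmxA.
  move=> /inj/rowP/(_ 1).
  by rewrite !mxE /= => /eqP; rewrite oner_eq0.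
- have [r0|r0] := eqVneq (r 0 0) 0; last first.
    have : bil L (y *m h') (y *m h') = 0 by rewrite bil_mul.
    rewrite bilLE yhF -/B BE !bilE mul0r mulr0 !add0r.
    by move/eqP; rewrite !mulf_eq0 (negPf r0) /= => /eqP.
  have r1 : r 0 1 != 0.
    apply/eqP => r1; move: rNh; rewrite NE r0 r1 !scale0r addr0 mul0mx => /rowP/(_ iE).
    by rewrite eE mxE => /eqP; rewrite eq_sym oner_eq0.
  have : bil L (e *m h') (e *m h') = 0 by rewrite bil_mul.
  rewrite bilLE ehF -/A AE !bilE mul0r mulr0 !add0r.
  by move/eqP; rewrite !mulf_eq0 oppr_eq0 (negPf r1) /= => /eqP.
move=> Z hZ.
pose c := map_mx (@ratr C).
have cE k l (M : 'M[rat]_(k, l)) : map_mx (@ratC R) M = c k l M by [].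
have cint k l (M : 'M[int]_(k, l)) : map_mx intr M = c k l (map_mx intr M).
  by apply/matrixP => i j; rewrite !mxE /intr rmorph_int.
have h'C : c _ _ h' *m map_mx intr L *m (c _ _ h')^T = map_mx intr L.
  by rewrite (cint _ _ L) -[X in _ = c _ _ X]h'G /c map_trmx -!map_mxM.
have cM k l p (M : 'M[rat]_(k, l)) (M2 : 'M[rat]_(l, p)) : c _ _ (M *m M2) = c _ _ M *m c _ _ M2.
  exact: map_mxM.
have cy : c _ _ y = row_mx 0 (c _ _ Y1) by rewrite /c /y map_row_mx map_mx0.
have ce : c _ _ e = delta_mx 0 iE.
  by apply/rowP => i; rewrite !mxE; case: (_ && _); rewrite ?rmorph0 ?rmorph1.
have wD := inConeD_wZ hZ.
have := hD _ wD; case: (gG) => _ [_ [_ gD]] => /gD.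
rewrite cint cE -mulmxA -map_mxM -/h'; rewrite -/(c _ _ h').
case=> t [t0 [Z' [hZ' wE]]]; exists t, Z'; split=> // s.
have YYC : bil L1 (c _ _ Y1) (c _ _ Y1) = 0 by rewrite bil_map YY rmorph0.
rewrite !cE -mulmxA -map_mxM -/h' -/(c _ _ h').
set x := _ *m _.
have xx : bil L x x = 0 by rewrite bil_mul // wZ_isotropic.
pose tau := bil L1 Z (c _ _ Y1).
have xE : x = t *: wZ S0 Z' + s *: (c _ _ (y *m h') - tau *: c _ _ (e *m h')).
  rewrite /x wZ_shift // mulmxDl wE -scalemxAl mulmxBl -scalemxAl.
  by rewrite !cM -cy -ce.
(* The direction of the line has no [f'] coordinate, so the automorphy factor does not depend on
   s. *)
have xF : x 0 iF = t.
  rewrite xE !rowE_lin wZ_F ![c _ _ _ _ _]mxE ehF yhF rmorph0; ring.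
(* Since [e'] is the image of r N under the isometry h', the coordinate t is the pairing of w(Z)
   with r N. *)
have tE : t = ratr (r 0 0) + ratr (r 0 1) * tau.
  have eC : c _ _ e = c _ _ (r *m N) *m c _ _ h' by rewrite -map_mxM rNh.
  have : bil L (wZ S0 Z *m c _ _ h') (c _ _ e) = t.
    rewrite wE bilLE !rowE_lin wZ_F ![c _ _ e _ _]mxE eE eF -map_rsubmx er map_mx0.
    by rewrite bil0r rmorph0 rmorph1; ring.
  move=> <-; rewrite eC bil_mul // NE /c map_mxD !map_mxZ !bilE.
  rewrite !bilLE wZ_F rsub_wZ -!map_rsubmx er yr map_mx0 bil0r.
  rewrite ![map_mx _ _ _ _]mxE eE eF yE yF !rmorph0 rmorph1.
  by rewrite -/(c _ _ Y1) -/tau; ring.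
rewrite [LHS](isotropic_wZ xx) xF //; congr (_ *: wZ _ _).
rewrite xE !rsubE_lin rsub_wZ -!map_rsubmx -/A -/B AE BE.
rewrite !map_mxZ scalerDr !scalerA (mulVf t0) scale1r; congr (_ + _).
rewrite -scalerBl rmorphN /= scalerA; congr (_ *: _).
by rewrite mulrN opprK [tau * _]mulrC -tE mulrAC (mulVf t0) mul1r.
Qed.

End CuspTransfer.

(** * Exponential series *)

Section Tends.
Variable R : realType.
Local Notation C := R[i].
Implicit Types (u v : nat -> C) (x y l : C).

Lemma le_Cr (a b : R) : (Cr a <= Cr b) = (a <= b). Proof. exact: lecR. Qed.
Lemma lt_Cr (a b : R) : (Cr a < Cr b) = (a < b). Proof. exact: ltcR. Qed.
Lemma CrD (a b : R) : Cr (a + b) = Cr a + Cr b. Proof. exact: (rmorphD (real_complex R)). Qed.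
Lemma CrM (a b : R) : Cr (a * b) = Cr a * Cr b. Proof. exact: (rmorphM (real_complex R)). Qed.
Lemma CrN (a : R) : Cr (- a) = - Cr a. Proof. exact: (rmorphN (real_complex R)). Qed.
Lemma CrV (a : R) : Cr a^-1 = (Cr a)^-1. Proof. exact: (fmorphV (real_complex R)). Qed.
Lemma Cr_sum (I : Type) (r : seq I) (P : pred I) (f : I -> R) :
  Cr (\sum_(i <- r | P i) f i) = \sum_(i <- r | P i) Cr (f i).
Proof. exact: (rmorph_sum (real_complex R)). Qed.
Lemma Cr_int (n : int) : Cr (n%:~R : R) = n%:~R. Proof. exact: (rmorph_int (real_complex R)). Qed.
Lemma norm_Cr (a : R) : 0 <= a -> `|Cr a| = Cr a.
Proof. by move=> a0; rewrite ger0_norm // -[0]/(Cr 0) le_Cr. Qed.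
Lemma ge0_Cr x : 0 <= x -> x = Cr (complex.Re x).
Proof. by move=> x0; rewrite /Cr RRe_real // ger0_real. Qed.

(** Convergence with real tolerances: the norm of a complex number lives in [C] itself, and real
    bounds are embedded by [Cr]. *)
Definition tends u l :=
  forall e : R, 0 < e -> exists N0, forall n, (N0 <= n)%N -> `|u n - l| < Cr e.

Lemma cvg_tends u l : (u @ \oo --> l)%classic -> tends u l.
Proof.
move=> h e e0; have e0C : 0 < Cr e by rewrite -[0]/(Cr 0) lt_Cr.
have {}h : ((u : nat -> C^o) @ \oo --> (l : C^o))%classic by exact: h.
have [N _ hN] := (cvgrPdist_lt _ _).1 h (Cr e) e0C.
by exists N => n /hN /=; rewrite distrC.
Qed.

Lemma cvg_pinfty (f : R -> C) :
  (forall e : R, 0 < e -> exists t0, forall t, t0 <= t -> `|f t| < Cr e) ->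
  (f @ +oo --> (0 : C))%classic.
Proof.
move=> h.
suff : ((f : R -> C^o) @ +oo --> (0 : C^o))%classic by [].
apply/cvgrPdist_lt => e e0; have eE := ge0_Cr (ltW e0).
have [|t0 ht] := h (complex.Re e); first by rewrite -lt_Cr -eE.
exists t0; split; first exact: num_real.
by move=> t /ltW/ht; rewrite sub0r normrN -eE.
Qed.

Lemma tends_cst x : tends (fun=> x) x.
Proof. by move=> e e0; exists 0%N => n _; rewrite subrr normr0 -[0]/(Cr 0) lt_Cr. Qed.

Lemma tends_eq u v l : tends u l -> (exists N, forall n, (N <= n)%N -> u n = v n) ->
  tends v l.
Proof.
move=> h [N hN] e /h[M hM]; exists (maxn N M) => n; rewrite geq_max => /andP[n1 n2].
by rewrite -hN // hM.
Qed.

Lemma tendsD u v x y : tends u x -> tends v y -> tends (fun n => u n + v n) (x + y).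
Proof.
move=> hu hv e e0; have e2 : 0 < e / 2 by rewrite divr_gt0.
have [N hN] := hu _ e2; have [M hM] := hv _ e2.
exists (maxn N M) => n; rewrite geq_max => /andP[/hN h1 /hM h2].
rewrite opprD addrACA (le_lt_trans (ler_normD _ _)) //.
by rewrite [e in Cr e]splitr CrD ltrD.
Qed.

Lemma tendsM x u y : tends u y -> tends (fun n => x * u n) (x * y).
Proof.
move=> hu e e0.
have [->|x0] := eqVneq x 0.
  by exists 0%N => n _; rewrite !mul0r subrr normr0 -[0]/(Cr 0) lt_Cr.
have nE := ge0_Cr (normr_ge0 x); set a := complex.Re _ in nE.
have a0 : 0 < a by rewrite -lt_Cr -nE normr_gt0.
have [|N hN] := hu (e / a); first by rewrite divr_gt0.
exists N => n /hN; rewrite -mulrBr normrM nE CrM CrV ltr_pdivlMr ?lt_Cr //.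
  by rewrite mulrC.
Qed.

Lemma tends_sum (I : Type) (r : seq I) (u : I -> nat -> C) (l : I -> C) :
  (forall i, tends (u i) (l i)) ->
  tends (fun n => \sum_(i <- r) u i n) (\sum_(i <- r) l i).
Proof.
move=> h; elim: r => [|i r IH].
  by rewrite big_nil; apply: (tends_eq (@tends_cst 0)); exists 0%N => n _; rewrite big_nil.
rewrite big_cons; apply: (tends_eq (tendsD (h i) IH)).
by exists 0%N => n _; rewrite big_cons.
Qed.

Lemma tends_norm_le u l (M : R) : tends u l ->
  (exists N, forall n, (N <= n)%N -> `|u n| <= Cr M) -> `|l| <= Cr M.
Proof.
move=> hu [N hN]; have nE := ge0_Cr (normr_ge0 l); rewrite nE le_Cr.
apply/ler_addgt0Pr => e e0; rewrite -le_Cr -nE.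
have [N' hN'] := hu e e0; set n := maxn N N'.
have h1 := hN n (leq_maxl _ _); have h2 := hN' n (leq_maxr _ _).
rewrite -[l](subrK (u n)) addrC CrD (le_trans (ler_normD _ _)) // lerD //.
by rewrite distrC ltW.
Qed.

Lemma tends_unique u l l' : tends u l -> tends u l' -> l = l'.
Proof.
move=> h h'; apply/eqP; rewrite -subr_eq0 -normr_le0 -[0]/(Cr 0).
apply: (@tends_norm_le (fun n => u n + -1 * u n)); last first.
  by exists 0%N => n _; rewrite mulN1r subrr normr0.
by rewrite -[- l']mulN1r; apply/tendsD/tendsM.
Qed.

End Tends.

Section Exponential.
Variable R : realType.
Local Notation C := R[i].

Lemma ee_complex (x : C) : ee x =
  Complex (expR (- (2 * pi * complex.Im x)) * cos (2 * pi * complex.Re x))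
          (expR (- (2 * pi * complex.Im x)) * sin (2 * pi * complex.Re x)).
Proof. by rewrite /ee -complexiE; apply: complex_eq; rewrite !ReImE /Cr /=; ring. Qed.

Lemma eeD (x y : C) : ee (x + y) = ee x * ee y.
Proof.
rewrite !ee_complex; apply: complex_eq; rewrite !ReImE /= !mulrDr opprD expRD.
  by rewrite cosD; ring.
by rewrite sinD; ring.
Qed.

Lemma norm_ee (x : C) : `|ee x| = Cr (expR (- (2 * pi * complex.Im x))).
Proof.
rewrite normc_def ee_complex /= !exprMn -mulrDr cos2Dsin2 mulr1 sqrtr_sqr ger0_norm //.
Qed.

Lemma ee0 : ee (0 : C) = 1.
Proof.
by rewrite ee_complex /= !mulr0 oppr0 expR0 cos0 sin0 mulr1 mulr0.
Qed.

Lemma norm_ee_real (x : R) : `|ee (Cr x)| = 1.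
Proof. by rewrite norm_ee /= mulr0 oppr0 expR0. Qed.

Lemma ee1 : ee (1 : C) = 1.
Proof.
by rewrite ee_complex /= mulr0 oppr0 expR0 !mul1r !mulr1 mulr_natl cos2pi sin2pi.
Qed.

Lemma ee_muln (x : C) n : ee (x *+ n) = ee x ^+ n.
Proof. by elim: n => [|n IH]; rewrite ?mulr0n ?ee0 // mulrS exprS eeD IH. Qed.

Lemma ee_int (n : int) : ee (n%:~R : C) = 1.
Proof.
have hn (p : nat) : ee (p%:R : C) = 1 by rewrite ee_muln ee1 expr1n.
case: n => p; first exact: hn.
rewrite NegzE mulrNz; apply: (@mulIf _ (ee p.+1%:R)); first by rewrite hn oner_neq0.
by rewrite -eeD addNr ee0 hn mulr1.
Qed.

Lemma ee_neq1 (x : R) : 0 < `|x| -> `|x| < 2^-1 -> ee (Cr x) != 1.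
Proof.
move=> x0 x1; apply/eqP; move/(congr1 (@complex.Re R)).
rewrite ee_complex /= mulr0 oppr0 expR0 mul1r.
have p0 := pi_gt0 R; rewrite -[X in _ = X](cos0 R).
rewrite -cos_norm !normrM normr_nat (ger0_norm (ltW p0)) => /cos_inj.
have lt0 : 0 < 2 * pi * `|x| by rewrite !mulr_gt0.
rewrite !in_itv /= lexx (ltW lt0) (ltW p0) /= => h.
have : 2 * pi * `|x| = 0.
  apply: h => //; have : 2 * pi * `|x| < 2 * pi * 2^-1 by rewrite ltr_pM2l // mulr_gt0.
  by move/ltW/le_trans; apply; rewrite mulrAC mulfV // mul1r.
by move=> e; move: lt0; rewrite e ltxx.
Qed.

(* With [2Q] sample points the frequency [p / 2Q] lies in (-1/2, 1/2). *)
Lemma ee_orthogonal (Q : nat) (p : int) : (`|p| < Q)%N ->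
  (Q.*2%:R)^-1 * (\sum_(j < Q.*2) ee (Cr (j%:R * (p%:~R / Q.*2%:R)))) = (p == 0)%:R :> C.
Proof.
move=> pQ; have W0 : Q.*2%:R != 0 :> R by rewrite pnatr_eq0 double_eq0; case: Q pQ.
have W0C : Q.*2%:R != 0 :> C by rewrite pnatr_eq0 double_eq0; case: Q pQ {W0}.
have [->|p0] := eqVneq p 0.
  rewrite mulr0z mul0r; under eq_bigr do rewrite mulr0 ee0.
  by rewrite sumr_const card_ord mulVf.
pose x : R := p%:~R / Q.*2%:R; pose z := ee (Cr x).
under eq_bigr => j _.
  have -> : ee (Cr (j%:R * x)) = z ^+ j.
    by rewrite -ee_muln mulr_natl /Cr rmorphMn.
over.
have z1 : z != 1.
  apply: ee_neq1; first by rewrite normr_gt0 mulf_neq0 ?invr_eq0 // intr_eq0.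
  rewrite normrM normfV normr_nat ltr_pdivrMr ?lt0r ?W0 ?ler0n //.
  by rewrite -intr_norm -muln2 natrM mulrCA mulVf // mulr1 -pmulrn ltr_nat; move: pQ; lia.
have : (z - 1) * (\sum_(j < Q.*2) z ^+ j) = 0.
  rewrite -subrX1 /z -ee_muln.
  have -> : Cr x *+ Q.*2 = p%:~R.
    by rewrite /x -[LHS](rmorphMn (real_complex R)) -mulr_natr mulfVK //; exact: Cr_int.
  by rewrite ee_int subrr.
by move/eqP; rewrite mulf_eq0 subr_eq0 (negPf z1) /= => /eqP->; rewrite mulr0.
Qed.

End Exponential.

(** * Absolutely summable families and finite averaging *)

Section BoxSums.
Variables (R : realType) (k : nat).
Local Notation C := R[i].
Implicit Types (g b : 'rV[int]_k -> C) (c : 'rV[int]_k).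

Definition box_point (N : nat) (f : {ffun 'I_k -> 'I_(N.*2.+1)}) : 'rV[int]_k :=
  \row_i ((f i : nat)%:Z - N%:Z).

Definition in_box (T : nat) c : bool := [forall i, (`|c 0%R i| <= T)%N].

Lemma box_pointP T c : in_box T c -> exists f, box_point (N := T) f = c.
Proof.
move=> /forallP h; exists [ffun i => inord `|c 0%R i + T%:Z|].
apply/rowP => i; rewrite !mxE ffunE inordK; have := h i; lia.
Qed.

Lemma in_box_point T f : in_box T (box_point (N := T) f).
Proof. by apply/forallP => i; rewrite mxE; have := ltn_ord (f i); lia. Qed.

Lemma box_point_inj N : injective (box_point (N := N)).
Proof.
move=> f f' /rowP h; apply/ffunP => i; apply/val_inj.
by have := h i; rewrite !mxE /=; lia.
Qed.

Lemma box_bounded (f : 'rV[int]_k -> nat) T :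
  exists Q, forall c, in_box T c -> (f c <= Q)%N.
Proof.
exists (\max_(x : {ffun 'I_k -> 'I_(T.*2.+1)}) f (box_point x)) => c /box_pointP[x <-].
exact: (@leq_bigmax_cond _ xpredT (fun x => f (box_point x))).
Qed.

Lemma box_sumE N g : box_sum N g = \sum_(f : {ffun 'I_k -> 'I_(N.*2.+1)}) g (box_point f).
Proof. by []. Qed.

Lemma box_sum_split T N g : (T <= N)%N ->
  box_sum N g = box_sum T g + \sum_(f | ~~ in_box T (box_point (N := N) f)) g (box_point f).
Proof.
move=> TN; rewrite box_sumE (bigID (fun f => in_box T (box_point f))) /=; congr (_ + _).
(* The same lattice point has indices differing by N - T in the two boxes, because indices are
   counted from the corner. *)
pose up (f : {ffun 'I_k -> 'I_(T.*2.+1)}) : {ffun 'I_k -> 'I_(N.*2.+1)} :=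
  [ffun i => inord (f i + (N - T))].
pose down (f : {ffun 'I_k -> 'I_(N.*2.+1)}) : {ffun 'I_k -> 'I_(T.*2.+1)} :=
  [ffun i => inord (f i - (N - T))].
have upE f : box_point (up f) = box_point f.
  apply/rowP => i; rewrite !mxE ffunE inordK; have := ltn_ord (f i); lia.
rewrite (reindex_onto up down) /=; last first.
  move=> f /box_pointP[x xE]; apply: box_point_inj; rewrite upE -xE; congr box_point.
  apply/ffunP => i; apply/val_inj; rewrite ffunE /=.
  move/rowP/(_ i): xE; rewrite !mxE => xE.
  by rewrite inordK; have := ltn_ord (x i); have := ltn_ord (f i); move: xE; lia.
rewrite box_sumE; apply: eq_big => [f|f _]; last by rewrite upE.
rewrite upE in_box_point; apply/eqP; apply: box_point_inj; rewrite -(upE (down _)).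
rewrite -[RHS]upE; congr box_point; apply/ffunP => i; apply/val_inj.
by rewrite !ffunE /= !inordK; have := ltn_ord (f i); lia.
Qed.

Lemma box_sum_ge0 b N : 0 <= box_sum N (fun c => `|b c|).
Proof. by rewrite sumr_ge0. Qed.

(** The sums of absolute values are bounded; a box whose sum comes within e of the supremum leaves
    at most e outside. *)
Lemma box_sum_tail b (B : C) (e : R) : (forall N, box_sum N (fun c => `|b c|) <= B) -> 0 < e ->
  exists T, forall N, (T <= N)%N ->
    \sum_(f | ~~ in_box T (box_point (N := N) f)) `|b (box_point f)| <= Cr e.
Proof.
move=> hB e0; pose r N := complex.Re (box_sum N (fun c => `|b c|)).
have rE N : box_sum N (fun c => `|b c|) = Cr (r N) by rewrite -ge0_Cr // box_sum_ge0.
have BE : B = Cr (complex.Re B) by apply/ge0_Cr/(le_trans _ (hB 0%N))/box_sum_ge0.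
have hub : has_ubound (range r).
  by exists (complex.Re B) => _ [N _ <-]; rewrite -le_Cr -rE -BE.
have hs : has_sup (range r) by split=> //; exists (r 0%N), 0%N.
have [_ [T _ <-] hT] := sup_adherent e0 hs.
exists T => N TN; have := box_sum_split (fun c => `|b c|) TN.
rewrite !rE => h; rewrite -(lerD2l (Cr (r T))) -h -CrD le_Cr.
have : r N <= sup (range r) by apply: ub_le_sup => //; exists N.
by move: hT; lra.
Qed.

(** Presents a single coefficient as a twisted series, so that a coefficient estimate becomes an
    instance of [multiplier_bound]. *)
Lemma box_sum_delta b c0 : tends (fun N => box_sum N (fun c => b c * (c == c0)%:R)) (b c0).
Proof.
have [N0 hN0] : exists N0, in_box N0 c0.
  exists (\max_i `|c0 0%R i|)%N; apply/forallP => i.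
  exact: (@leq_bigmax_cond _ xpredT (fun i => `|c0 0%R i|%N)).
apply: (tends_eq (tends_cst (b c0))); exists N0 => N NN0.
have [|f0 fE] := @box_pointP N c0.
  by apply/forallP => i; apply: leq_trans NN0; apply: (forallP hN0).
rewrite box_sumE (bigD1 f0) //= fE eqxx mulr1 big1 ?addr0 // => f ff0.
by rewrite -fE (inj_eq (@box_point_inj N)) (negPf ff0) mulr0.
Qed.

(* Instead of integrating over a torus one averages the sums [S j] of the twisted
   series against a finite kernel [kap] reproducing [mu] on a large box. *)
Lemma multiplier_bound b mu (B l : C) (M A : R) : 0 <= M -> 0 <= A ->
  (forall N, box_sum N (fun c => `|b c|) <= B) ->
  (forall c, `|mu c| <= 1) ->
  (forall T, exists n (chi : 'I_n -> 'rV[int]_k -> C) (kap S : 'I_n -> C),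
    [/\ forall j c, `|chi j c| <= 1,
        forall j, `|S j| <= Cr M /\ tends (fun N => box_sum N (fun c => b c * chi j c)) (S j),
        \sum_j `|kap j| <= Cr A &
        forall c, in_box T c -> b c != 0 -> \sum_j kap j * chi j c = mu c]) ->
  tends (fun N => box_sum N (fun c => b c * mu c)) l -> `|l| <= Cr (M * A).
Proof.
move=> M0 A0 hB hmu ker hl.
have nE := ge0_Cr (normr_ge0 l); rewrite nE le_Cr.
apply/ler_addgt0Pr => e e0; rewrite -le_Cr -nE.
(* Outside the box the error multiplier is at most 1 + A: 1 from [mu] and A from the average. *)
have A1 : 0 < 1 + A by lra.
have [T hT] := box_sum_tail hB (divr_gt0 e0 A1).
have [n [chi [kap [S [hchi hS hkap hmuE]]]]] := ker T.
have ht : tends (fun N => \sum_(j < n) kap j * box_sum N (fun c => b c * chi j c))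
    (\sum_(j < n) kap j * S j).
  by apply: tends_sum => j; apply: tendsM; case: (hS j).
have hd := tendsD hl (tendsM (-1) ht).
have key : `|l + -1 * (\sum_(j < n) kap j * S j)| <= Cr e.
  apply: (tends_norm_le hd); exists T => N TN.
  have -> : box_sum N (fun c => b c * mu c) +
     -1 * (\sum_(j < n) kap j * box_sum N (fun c => b c * chi j c)) =
     box_sum N (fun c => b c * (mu c - \sum_(j < n) kap j * chi j c)).
    rewrite mulN1r !box_sumE.
    under [X in _ - X]eq_bigr => j _ do rewrite box_sumE mulr_sumr.
    rewrite exchange_big /= -sumrB; apply: eq_bigr => f _.
    by rewrite mulrBr mulr_sumr; congr (_ - _); apply: eq_bigr => j _; rewrite mulrCA.
  rewrite (box_sum_split _ TN) [box_sum T _]big1 => [|f _]; last first.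
    have [->|b0] := eqVneq (b (\row_i ((f i : nat)%:Z - T%:Z))) 0; first by rewrite mul0r.
    by rewrite hmuE ?subrr ?mulr0 //; apply: in_box_point.
  rewrite add0r (le_trans (ler_norm_sum _ _ _)) //.
  apply: (@le_trans _ _ (\sum_(f | ~~ in_box T (box_point (N := N) f))
     `|b (box_point f)| * Cr (1 + A))).
    apply: ler_sum => f _; rewrite normrM ler_wpM2l //.
    rewrite (le_trans (ler_normB _ _)) // CrD lerD //.
    rewrite (le_trans (ler_norm_sum _ _ _)) // (le_trans _ hkap) //.
    by apply: ler_sum => j _; rewrite normrM ler_piMr.
  rewrite -mulr_suml -(divfK (lt0r_neq0 A1) e) CrM ler_wpM2r //.
    by rewrite -[0]/(Cr 0) le_Cr ltW.
  exact: hT.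
rewrite -[l](subrK (\sum_(j < n) kap j * S j)) addrC CrD (le_trans (ler_normD _ _)) //.
rewrite lerD //; last by rewrite -mulN1r.
rewrite (le_trans (ler_norm_sum _ _ _)) // mulrC CrM.
apply: (@le_trans _ _ (\sum_(j < n) `|kap j| * Cr M)).
  by apply: ler_sum => j _; rewrite normrM ler_wpM2l //; case: (hS j).
by rewrite -mulr_suml ler_wpM2r // -[0]/(Cr 0) le_Cr.
Qed.

(* Uniqueness of balanced digits: a single large integer [beta] turns distinct points
   of a box into distinct frequencies. *)
Lemma digits_inj (beta : int) l (d : 'I_l -> int) :
  (forall i, `|d i| < beta) -> \sum_(i < l) d i * beta ^+ i = 0 -> forall i, d i = 0.
Proof.
elim: l d => [|l IH] d hd h; first by case.
rewrite big_ord_recl expr0 mulr1 in h.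
have h' : d ord0 = - (beta * (\sum_(i < l) d (lift ord0 i) * beta ^+ i)).
  apply/eqP; rewrite -addr_eq0 mulr_sumr -[X in _ == X]h; apply/eqP; congr (_ + _).
  by apply: eq_bigr => i _; rewrite /= exprS mulrCA.
have d0 : d ord0 = 0.
  have := hd ord0; rewrite h' normrN normrM.
  set s := \sum_(i < l) _; have := hd ord0; have [->|s0] := eqVneq s 0.
    by rewrite normr0 !mulr0 oppr0.
  nia.
have s0 : \sum_(i < l) d (lift ord0 i) * beta ^+ i = 0.
  move: h'; rewrite d0; have := hd ord0; rewrite d0 normr0 => b0.
  by set s := \sum_(i < l) _; nia.
move=> i; case: (unliftP ord0 i) => [j ->|-> //].
exact: (IH (fun j => d (lift ord0 j)) (fun j => hd _) s0).
Qed.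

(** Cauchy's estimate on a torus: the multiplier is the indicator of [c0], reproduced on a box by a
    kernel of total mass 1. *)
Lemma fourier_coefficient_bound b (B : C) (M : R) c0 : 0 <= M ->
  (forall N, box_sum N (fun c => `|b c|) <= B) ->
  (forall X : 'rV[R]_k, exists2 S, `|S| <= Cr M &
    tends (fun N => box_sum N (fun c => b c * ee (Cr (\sum_i (c 0 i)%:~R * X 0 i)))) S) ->
  `|b c0| <= Cr M.
Proof.
move=> M0 hB hS; rewrite -[M]mulr1.
apply: (multiplier_bound M0 ler01 hB _ _ (@box_sum_delta b c0)).
  by move=> c; case: (_ == _); rewrite ?normr1 ?normr0.
move=> T.
(* [D] bounds the coordinate differences from [c0] on the box, so base D + 1 separates its points
   from [c0]. [Q0] bounds the resulting frequency differences, so 2(Q0 + 1) sample points suffice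
   for orthogonality. *)
have [D hD] := box_bounded (fun c => \max_i `|c 0%R i - c0 0%R i|)%N T.
pose beta : int := D.+1.
pose fr c : int := \sum_i c 0 i * beta ^+ i.
have [Q0 hQ] := box_bounded (fun c => `|fr c - fr c0|%N) T.
pose W : R := Q0.+1.*2%:R.
pose X (j : 'I_(Q0.+1.*2)) : 'rV[R]_k := \row_i (j%:R / W * (beta ^+ i)%:~R).
have frE j c : \sum_i (c 0 i)%:~R * X j 0 i = j%:R / W * (fr c)%:~R.
  rewrite /fr rmorph_sum mulr_sumr; apply: eq_bigr => i _.
  by rewrite mxE rmorphM /= mulrCA.
have /choice[S hS'] : forall j, exists S, `|S| <= Cr M /\
    tends (fun N => box_sum N (fun c => b c * ee (Cr (\sum_i (c 0 i)%:~R * X j 0 i)))) S.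
  by move=> j; have [S h1 h2] := hS (X j); exists S.
exists (Q0.+1.*2), (fun j c => ee (Cr (\sum_i (c 0 i)%:~R * X j 0 i))),
  (fun j => (Q0.+1.*2%:R)^-1 * ee (Cr (- (j%:R / W * (fr c0)%:~R)))), S.
have W0 : (Q0.+1.*2%:R : C) != 0 by rewrite pnatr_eq0.
split=> [j c|j||c cT _]; rewrite ?norm_ee_real //.
  under eq_bigr do rewrite normrM norm_ee_real mulr1 normfV normr_nat.
  by rewrite sumr_const card_ord -[X in X <= _]mulr_natr mulVf.
have := @ee_orthogonal R Q0.+1 (fr c - fr c0) _; rewrite ltnS => /(_ (hQ c cT)).
rewrite subr_eq0 mulr_sumr => h.
transitivity ((fr c == fr c0)%:R : C).
  rewrite -h; apply: eq_bigr => j _; rewrite /= -[LHS]mulrA -eeD frE -CrD; congr (_ * ee (Cr _)).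
  by rewrite rmorphB /= /W mulrBl mulrBr; ring.
congr (nat_of_bool _)%:R; apply/eqP/eqP => [e|-> //].
apply/rowP => i; apply/eqP; rewrite -subr_eq0; apply/eqP.
apply: (@digits_inj beta _ (fun i => c 0 i - c0 0 i)) => [l|].
  have : (`|c 0%R l - c0 0%R l| <= D)%N.
    apply: leq_trans (hD c cT).
    exact: (@leq_bigmax_cond _ xpredT (fun i => `|c 0%R i - c0 0%R i|%N)).
  by rewrite /beta; lia.
have /eqP := e; rewrite -subr_eq0 /fr -sumrB => /eqP e0; rewrite -[RHS]e0.
by apply: eq_bigr => l _; rewrite mulrBl.
Qed.

(* A series of exponentials with positive integral frequencies behaves like a
   holomorphic function of [q] vanishing at the origin (Schwarz's lemma). *)
Lemma schwarz_bound b (B l : C) (nu : 'rV[int]_k -> int) (rho M : R) :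
  0 <= M -> 0 <= rho < 1 ->
  (forall N, box_sum N (fun c => `|b c|) <= B) ->
  (forall c, b c != 0 -> 0 < nu c) ->
  (forall x : R, exists2 S, `|S| <= Cr M &
    tends (fun N => box_sum N (fun c => b c * ee (Cr (x * (nu c)%:~R)))) S) ->
  tends (fun N => box_sum N (fun c => b c * Cr (rho ^+ `|nu c|%N))) l ->
  `|l| <= Cr (M * (rho / (1 - rho))).
Proof.
move=> M0 /andP[r0 r1] hB nu0 hS.
have r1' : 0 < 1 - rho by lra.
apply: (multiplier_bound M0 _ hB) => [||T].
- by rewrite divr_ge0 // ltW.
- by move=> c; rewrite norm_Cr ?exprn_ge0 // -[1]/(Cr 1) le_Cr exprn_ile1 // ltW.
have [Q0 hQ] := box_bounded (fun c => `|nu c|%N) T.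
pose W : R := Q0.+1.*2%:R.
have /choice[S hS'] : forall j : 'I_(Q0.+1.*2), exists S, `|S| <= Cr M /\
    tends (fun N => box_sum N (fun c => b c * ee (Cr (j%:R / W * (nu c)%:~R)))) S.
  by move=> j; have [S h1 h2] := hS (j%:R / W); exists S.
(* A discrete Fourier transform of rho^n for 1 <= n <= Q0 + 1. The absence of n = 0 brings the mass
   down to rho / (1 - rho). *)
pose kap (j : 'I_(Q0.+1.*2)) : C := (Q0.+1.*2%:R)^-1 *
  \sum_(n < Q0.+1) Cr (rho ^+ n.+1) * ee (Cr (- (j%:R / W * n.+1%:R))).
exists (Q0.+1.*2), (fun j c => ee (Cr (j%:R / W * (nu c)%:~R))), kap, S.
have W0 : (Q0.+1.*2%:R : C) != 0 by rewrite pnatr_eq0.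
split=> [j c|j||c cT bc]; rewrite ?norm_ee_real //.
  have kapn j : `|kap j| <= (Q0.+1.*2%:R)^-1 * Cr (rho / (1 - rho)).
    rewrite normrM normfV normr_nat ler_wpM2l ?invr_ge0 ?ler0n //.
    rewrite (le_trans (ler_norm_sum _ _ _)) //.
    under eq_bigr do rewrite normrM norm_ee_real mulr1 norm_Cr ?exprn_ge0 //.
    rewrite -Cr_sum le_Cr ler_pdivlMr //.
    under eq_bigr do rewrite exprS.
    rewrite -mulr_sumr -mulrA ler_piMr //.
    have := subrX1 rho Q0.+1; have := exprn_ge0 Q0.+1 r0; lra.
  rewrite (le_trans (ler_sum _ (fun j _ => kapn j))) // sumr_const card_ord.
  by rewrite -[X in X <= _]mulr_natr mulrAC mulVf // mul1r.
have [n nE] : exists n : 'I_Q0.+1, nu c = n.+1.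
  have n0 := nu0 c bc; have nQ := hQ c cT.
  have lt : (`|nu c|.-1 < Q0.+1)%N by lia.
  by exists (Ordinal lt) => /=; lia.
rewrite nE absz_nat.
transitivity (\sum_(p < Q0.+1) Cr (rho ^+ p.+1) * ((nu c - p.+1%:Z == 0)%:R : C)).
  under eq_bigr => j _ do rewrite /kap -(mulrA (_^-1)) mulr_suml.
  rewrite -mulr_sumr exchange_big mulr_sumr /=; apply: eq_bigr => p _.
  rewrite -(@ee_orthogonal R Q0.+1); last by rewrite nE; have := ltn_ord p; have := ltn_ord n; lia.
  rewrite [RHS]mulrCA; congr (_ * _); rewrite mulr_sumr; apply: eq_bigr => j _.
  rewrite /= -[LHS]mulrA -eeD -CrD; congr (_ * ee (Cr _)).
  by rewrite nE rmorphB /= /W -!pmulrn; ring.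
rewrite (bigD1 n) //= nE subrr eqxx mulr1 big1 ?addr0 // => p pn.
rewrite subr_eq0 (_ : (_ == _) = false) ?mulr0 //.
by apply/negP => /eqP[] /val_inj e; rewrite e eqxx in pn.
Qed.

End BoxSums.

(** * The Fourier expansion and the Koecher principle *)

(** The pairing of L1^v with L1: the Gram matrix cancels against its inverse in [dualvec]. *)
Definition pairing {K : comNzRingType} k (c : 'rV[int]_k) (Z : 'rV[K]_k) : K :=
  \sum_i (c 0 i)%:~R * Z 0 i.

Lemma pairingD (K : comNzRingType) k c (Y Z : 'rV[K]_k) :
  pairing c (Y + Z) = pairing c Y + pairing c Z.
Proof. by rewrite -big_split; apply: eq_bigr => i _; rewrite mxE mulrDr. Qed.

Lemma pairingZ (K : comNzRingType) k c (a : K) (Y : 'rV[K]_k) :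
  pairing c (a *: Y) = a * pairing c Y.
Proof. by rewrite mulr_sumr; apply: eq_bigr => i _; rewrite mxE mulrCA. Qed.

Lemma pairing_map (K K' : comNzRingType) (f : {rmorphism K -> K'}) k c (Y : 'rV[K]_k) :
  pairing c (map_mx f Y) = f (pairing c Y).
Proof.
rewrite /pairing rmorph_sum; apply: eq_bigr => i _.
by rewrite mxE rmorphM /= rmorph_int.
Qed.

Section Fourier.
Variables (R : realType) (m : nat) (S0 : 'M[int]_m).
Hypothesis S0P : even_negdef_gram R S0.
Local Notation C := R[i].
Local Notation toC := (real_complex R).
Local Notation L1 := (Gram1 S0).
Local Notation L := (GramL S0).
Local Notation iE := (lshift (2 + m) (0 : 'I_2)).
Local Notation iF := (lshift (2 + m) (1 : 'I_2)).
Local Notation i0 := (rshift 2 (lshift m (0 : 'I_2))).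
Local Notation i1 := (rshift 2 (lshift m (1 : 'I_2))).

(** Reversed Cauchy-Schwarz, from (x0 Y' - y0 l', x0 Y' - y0 l') <= 0 in L0. If y0 = 0 then Y' = 0,
    and the sign of Y has to be read from its second coordinate. *)
Lemma lightcone_pos (l Y : 'rV[R]_(2 + m)) : posCone S0 l -> Y != 0 ->
  bil L1 Y Y = 0 -> 0 <= Y 0 (lshift m 0) ->
  (Y 0 (lshift m 0) = 0 -> 0 <= Y 0 (lshift m 1)) -> 0 < bil L1 l Y.
Proof.
move=> [ll l0] Yn YY Y0 Y1.
set y0 := Y 0 (lshift m 0) in Y0 Y1 *; set y1 := Y 0 (lshift m 1) in Y1 *.
set x0 := l 0 (lshift m 0) in l0 *; set x1 := l 0 (lshift m 1).
move: ll YY; rewrite !bil1E -/y0 -/y1 -/x0 -/x1.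
set l' := rsubmx l; set Y' := rsubmx Y => ll YY.
have [y00|y0n] := eqVneq y0 0.
  have Y'0 : Y' = 0 by apply: (negdef_eq0 S0P); move: YY; rewrite y00; lra.
  rewrite y00 Y'0 bil0r mulr0 addr0 addr0 mulr_gt0 // lt0r Y1 // andbT.
  apply: contra Yn => /eqP y10; apply/eqP; apply: rowU_eq.
  - by rewrite -/y0 y00 mxE.
  - by rewrite -/y1 y10 mxE.
  by rewrite -/Y' Y'0; apply/rowP => i; rewrite !mxE.
have y0p : 0 < y0 by rewrite lt0r y0n.
have := negdef_le0 S0P (x0 *: Y' - y0 *: l').
rewrite !bilE (bilC (proj1 S0P) Y' l') => h.
rewrite -(pmulr_rgt0 _ (mulr_gt0 y0p l0)).
have := mulr_gt0 (mulr_gt0 y0p y0p) ll.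
have : bil S0 Y' Y' = - (y0 * y1 + y1 * y0) by lra.
move: h; set s := bil S0 l' Y'; set p := bil S0 Y' Y'; set q := bil S0 l' l'.
move=> h pE hl; rewrite pE in h; nra.
Qed.

Lemma posCone_shift (V Y : 'rV[R]_(2 + m)) (t : R) : posCone S0 V -> Y != 0 ->
  bil L1 Y Y = 0 -> 0 <= Y 0 (lshift m 0) ->
  (Y 0 (lshift m 0) = 0 -> 0 <= Y 0 (lshift m 1)) -> 0 <= t -> posCone S0 (V + t *: Y).
Proof.
move=> hV Yn YY Y0 Y1 t0; have := lightcone_pos hV Yn YY Y0 Y1.
case: hV => VV V0 VY; have tVY := mulr_ge0 t0 (ltW VY); have tY0 := mulr_ge0 t0 Y0.
split; last by rewrite !rowE_lin; lra.
by rewrite !bilE YY (bilC (symGram1 S0P) Y V); lra.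
Qed.

(** An affine function positive on [0, +oo) has nonnegative slope; this is applied to a coordinate
    and to the norm along the ray. It recovers the orientation of a direction transported by
    Gamma. *)
Lemma lightcone_ray (V Y : 'rV[R]_(2 + m)) :
  bil L1 Y Y = 0 -> (forall t, 0 <= t -> posCone S0 (V + t *: Y)) ->
  0 <= Y 0 (lshift m 0) /\ (Y 0 (lshift m 0) = 0 -> 0 <= Y 0 (lshift m 1)).
Proof.
move=> YY h.
have ray (x y : R) : (forall t, 0 <= t -> 0 < x + t * y) -> 0 <= y.
  move=> hxy; rewrite leNgt; apply/negP => y0; have := hxy ((`|x| + 1) / - y).
  rewrite divr_ge0 ?addr_ge0 ?oppr_ge0 ?(ltW y0) // => /(_ isT).
  rewrite mulrAC invrN mulrN mulfK ?lt_eqF //; have := ler_norm x; lra.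
split; first by apply: (ray (V 0 (lshift m 0))) => t /h[_]; rewrite !rowE_lin.
move=> Y0; have V0 : 0 < V 0 (lshift m 0).
  by have [_] := h 0 (lexx _); rewrite !rowE_lin mul0r addr0.
have Y'0 : rsubmx Y = 0.
  by apply: (negdef_eq0 S0P); move: YY; rewrite bil1E Y0; lra.
rewrite -(pmulr_rge0 _ V0); apply: (ray (bil L1 V V / 2)) => t /h[+ _].
rewrite !bilE YY (bilC (symGram1 S0P) Y V) [bil L1 V Y]bil1E Y0 Y'0 bil0r; lra.
Qed.

Lemma pairing_dualvec (K : numFieldType) (c : 'rV[int]_(2 + m)) (Z : 'rV[K]_(2 + m)) :
  bil L1 (map_mx ratr (dualvec S0 c)) Z = pairing c Z.
Proof.
rewrite /bil.
have -> : map_mx intr L1 = map_mx (ratr : rat -> K) (map_mx intr L1).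
  by apply/matrixP => i j; rewrite !mxE /intr rmorph_int.
rewrite -map_mxM /dualvec mulmxKV ?(unit_L1 S0P) // mxE; apply: eq_bigr => i _.
by rewrite !mxE /intr rmorph_int.
Qed.

Lemma Im_pairing (c : 'rV[int]_(2 + m)) (Z : 'rV[C]_(2 + m)) :
  complex.Im (pairing c Z) = pairing c (ImV Z).
Proof.
rewrite {1}(vec_ReIm Z) pairingD pairingZ !pairing_map !ReImE /=; ring.
Qed.

Variables (k : int) (F : 'rV[C]_(2 + (2 + m)) -> C) (a : 'rV[rat]_(2 + m) -> C).
Hypotheses (modF : isModularForm S0 k F) (fourF : FourierExpansion S0 F a).
Local Notation ac c := (a (dualvec S0 c)).

Lemma fourier_sum Z : inTube S0 Z ->
  (exists2 B : R, 0 <= B & forall N, box_sum N (fun c => `|ac c * ee (pairing c Z)|) <= Cr B) /\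
  tends (fun N => box_sum N (fun c => ac c * ee (pairing c Z))) (F (wZ S0 Z)).
Proof.
move=> /(proj2 fourF)/=[[B hB] /cvg_tends hl].
have termE c : bil L1 (map_mx (@ratC R) (dualvec S0 c)) Z = pairing c Z.
  exact: pairing_dualvec.
have B0 : 0 <= B by apply: (le_trans _ (hB 0%N)); apply: box_sum_ge0.
split.
  exists (complex.Re B); first by rewrite -le_Cr -ge0_Cr.
  move=> N; rewrite -ge0_Cr //; apply: le_trans (hB N).
  by apply: ler_sum => f _; rewrite termE.
apply: (tends_eq hl); exists 0%N => N _.
by rewrite /box_sum; apply: eq_bigr => f _; rewrite termE.
Qed.

(** Real translations multiply each term by a number of modulus 1, so the absolute bound depends on
    Im Z alone. *)
Lemma F_bounded Z : inTube S0 Z -> exists2 M : R, 0 <= M &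
  forall X : 'rV[R]_(2 + m), `|F (wZ S0 (Z + map_mx toC X))| <= Cr M.
Proof.
move=> hZ; have [[B B0 hB] _] := fourier_sum hZ; exists B => // X.
have hX : inTube S0 (Z + map_mx toC X).
  rewrite /inTube; suff -> : ImV (Z + map_mx toC X) = ImV Z by [].
  by apply/rowP => i; rewrite !mxE ReImE /= addr0.
have [_ hl] := fourier_sum hX; apply: (tends_norm_le hl); exists 0%N => N _.
apply: le_trans (hB N); apply: (le_trans (ler_norm_sum _ _ _)).
apply: ler_sum => f _; rewrite pairingD eeD pairing_map mulrA normrM.
by rewrite [X in _ * X]norm_ee_real mulr1.
Qed.

Lemma F_gamma g v : inGamma R S0 g -> inConeD S0 v -> F (v *m map_mx intr g) = F v.
Proof. by move=> gG hv; case: modF => _ [_]; apply. Qed.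

(** Extended by zero to L, the transvection leaves the [f'] coordinate of w(Z) equal to 1. It thus
    acts linearly on the tube, with trivial automorphy factor. *)
Lemma wZ_eichler (v : 'rV[int]_(2 + m)) (q : int) (Z : 'rV[C]_(2 + m)) :
  let e : 'rV[int]_(2 + m) := delta_mx 0 (lshift m 1) in
  bil L1 e v = 0 -> bil L1 v v = q + q -> inTube S0 Z ->
  let Z' := Z *m map_mx intr (eichler L1 e v q) in
  inTube S0 Z' /\ F (wZ S0 Z') = F (wZ S0 Z).
Proof.
move=> e ev vv hZ Z'.
pose E : 'rV[int]_(2 + (2 + m)) := row_mx 0 e; pose V : 'rV[int]_(2 + (2 + m)) := row_mx 0 v.
have bE (K : comNzRingType) (x : 'rV[K]_(2 + (2 + m))) (u : 'rV[int]_(2 + m)) :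
    bil L x (map_mx intr (row_mx 0 u)) = bil L1 (rsubmx x) (map_mx intr u).
  by rewrite map_row_mx map_mx0 bilLE row_mxKr !row_mxEl !mxE !mulr0 !add0r.
have bEi (u u' : 'rV[int]_(2 + m)) : bil L (row_mx 0 u) (row_mx 0 u') = bil L1 u u'.
  by rewrite bilLE !row_mxKr !row_mxEl !mxE mulr0 !add0r.
have ee : bil L1 e e = 0.
  by rewrite bil1E [rsubmx e](_ : _ = 0) ?bil0l ?mxE //; apply/rowP => i; rewrite !mxE.
have gG : inGamma R S0 (eichler L E V q).
  by apply: (inGamma_eichler S0P); rewrite bEi.
have hc := inConeD_wZ hZ.
have xc : inConeD S0 (wZ S0 Z *m map_mx intr (eichler L E V q)).
  by case: gG => _ [_ [_]]; apply.
have FE := F_gamma gG hc.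
suff xE : wZ S0 Z *m map_mx intr (eichler L E V q) = 1 *: wZ S0 Z'.
  rewrite -FE xE scale1r; split=> //; rewrite xE in xc.
  by apply: (inTube_cone S0P _ xc); rewrite oner_neq0.
have xx : bil L (wZ S0 Z *m map_mx intr (eichler L E V q))
    (wZ S0 Z *m map_mx intr (eichler L E V q)) = 0.
  rewrite bil_mul ?wZ_isotropic //; case: gG => _ [gG _].
  by rewrite map_trmx -!map_mxM gG.
have xF : (wZ S0 Z *m map_mx intr (eichler L E V q)) 0 iF = 1.
  rewrite map_eichler mul_eichler !rowE_lin wZ_F ![map_mx _ _ _ _]mxE !row_mxEl !mxE.
  by rewrite !rmorph0 !mulr0 addr0 !subr0.
rewrite [LHS](isotropic_wZ xx) xF ?oner_neq0 // invr1 !scale1r.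
congr (wZ _ _); rewrite /Z' !map_eichler !mul_eichler !bE rsub_wZ.
by rewrite !rsubE_lin rsub_wZ -!map_rsubmx !row_mxKr.
Qed.

End Fourier.

(** * Koecher's principle and the support of the expansion *)

Section Koecher.
Variables (R : realType) (m : nat) (S0 : 'M[int]_m).
Hypotheses (m1 : (1 <= m)%N) (S0P : even_negdef_gram R S0).
Local Notation C := R[i].
Local Notation toC := (real_complex R).
Local Notation L1 := (Gram1 S0).
Local Notation L := (GramL S0).
Variables (k : int) (F : 'rV[C]_(2 + (2 + m)) -> C) (a : 'rV[rat]_(2 + m) -> C).
Hypotheses (modF : isModularForm S0 k F) (fourF : FourierExpansion S0 F a).
Local Notation ac c := (a (dualvec S0 c)).

Lemma quadratic_escape (q x y : R) (M : R) : 1 <= q ->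
  exists j : nat, M < j%:R * j%:R * q - j%:R * x - y.
Proof.
move=> q1; pose t := `|x| + `|y| + `|M| + 1.
exists (Num.bound t); set j : R := (Num.bound t)%:R.
have tj : t < j by apply: le_lt_trans (archi_boundP _) => //; rewrite !addr_ge0.
have h1 := ler_norm x; have h2 := ler_norm y; have h3 := ler_norm M.
have n1 := normr_ge0 x; have n2 := normr_ge0 y; have n3 := normr_ge0 M.
have j1 : 1 < j by apply: le_lt_trans tj; rewrite /t; lra.
have h : j * (`|x| + `|y| + `|M| + 1) < j * j by rewrite ltr_pM2l //; lra.
have hq : j * j <= j * j * q by rewrite ler_peMr // mulr_ge0; lra.
have hx : j * x <= j * `|x| by rewrite ler_wpM2l //; lra.
have hy : `|y| <= j * `|y| by rewrite ler_peMl //; lra.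
have hM : `|M| <= j * `|M| by rewrite ler_peMl //; lra.
lra.
Qed.

(* Koecher's principle: a coefficient outside the positive cone would grow along an
   infinite orbit of unipotent elements, while [sup_X |F(X + iY)|] is constant on it. *)
Lemma koecher (c : 'rV[int]_(2 + m)) : c 0 (lshift m 1) < 0 -> ac c = 0.
Proof.
move=> c1; pose e : 'rV[int]_(2 + m) := delta_mx 0 (lshift m 1).
(* A nonzero vector of L0, available because m >= 1; it has negative norm 2q and is orthogonal to
   e. *)
pose v1 : 'rV[int]_(2 + m) := row_mx 0 (const_mx 1).
have [q qE] := even_L1 S0P v1.
have q0 : q < 0.
  have : bil L1 (map_mx intr v1) (map_mx intr v1) < 0 :> R.
    rewrite map_row_mx map_mx0 bil1E row_mxKr !row_mxEl !mxE mulr0 !add0r.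
    case: S0P => _ [_]; apply; apply/eqP => /rowP/(_ (Ordinal m1)).
    by rewrite !mxE => /eqP; rewrite oner_eq0.
  by rewrite bil_int qE -[0]/(0%:~R) ltr_int; lia.
pose V j : 'rV[int]_(2 + m) := j%:Z *: v1.
pose Q (j : nat) : int := j%:Z * j%:Z * q.
have eV j : bil L1 e (V j) = 0.
  rewrite bilZr bil1E row_mxKr !row_mxEl [rsubmx e](_ : _ = 0).
    by rewrite bil0l !mxE !mulr0.
  by apply/rowP => i; rewrite !mxE.
have VV j : bil L1 (V j) (V j) = Q j + Q j by rewrite bilZr bilZl qE /Q; ring.
have ee0 : bil L1 e e = 0.
  by rewrite bil1E [rsubmx e](_ : _ = 0) ?bil0l ?mxE //; apply/rowP => i; rewrite !mxE.
pose Y0 : 'rV[R]_(2 + m) := row_mx (const_mx 1) 0.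
have Y0pos : posCone S0 Y0.
  by split; rewrite ?bil1E /Y0 ?row_mxKr ?bil0l !row_mxEl !mxE; lra.
pose g j := eichler L1 e (V j) (Q j).
pose Z0 : 'rV[C]_(2 + m) := 'i%C *: map_mx toC Y0.
have ImZ (X Y : 'rV[R]_(2 + m)) : ImV (map_mx toC X + 'i%C *: map_mx toC Y) = Y.
  by apply/rowP => i; rewrite !mxE !ReImE /=; ring.
have Z0t : inTube S0 Z0 by rewrite /inTube /Z0 -[_ *: _]add0r -(map_mx0 toC) ImZ.
have [M M0 hM] := F_bounded S0P fourF Z0t.
pose Z j := Z0 *m map_mx intr (g j).
have Zt j : inTube S0 (Z j) by case: (wZ_eichler S0P modF (eV j) (VV j) Z0t).
(* A real translation X at Z_j is the image of a real translation X' at Z0, so one bound M serves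
   all j. *)
have FX j X : `|F (wZ S0 (Z j + map_mx toC X))| <= Cr M.
  pose X' := X *m map_mx intr (eichler L1 e (- V j) (Q j)).
  have XE : map_mx toC X = map_mx toC X' *m map_mx intr (g j).
    have gg : eichler L1 e (- V j) (Q j) *m g j = 1%:M.
      exact/mulmx1C/(eichler_mulN (symGram1 S0P)).
    by rewrite map_intC -map_mxM /X' -mulmxA -map_mxM gg map_mx1 mulmx1.
  have ht : inTube S0 (Z0 + map_mx toC X') by rewrite /inTube addrC ImZ.
  have := (wZ_eichler S0P modF (eV j) (VV j) ht).2.
  by rewrite mulmxDl -XE => ->; apply: hM.
have YE j : ImV (Z j) = Y0 + map_mx intr (V j) - (Q j)%:~R *: map_mx intr e.
  rewrite /Z map_intC (ReIm_mulmx _ _).2 /Z0 -[_ *: _]add0r -(map_mx0 toC) ImZ.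
  rewrite map_eichler mul_eichler.
  have -> : bil L1 Y0 (map_mx intr e) = 1.
    rewrite bil1E /Y0 row_mxKr bil0l !row_mxEl !mxE /=.
    by rewrite /intr mulr1z mulr0z; ring.
  have -> : bil L1 Y0 (map_mx intr (V j)) = 0.
    rewrite map_mxZ bilZr /v1 map_row_mx map_mx0 bil1E /Y0 row_mxKr bil0l !row_mxEl !mxE.
    by ring.
  by rewrite scale1r scale0r subr0 mulr1.
have key j : `|ac c| * Cr (expR (- (2 * pi * pairing c (ImV (Z j))))) <= Cr M.
  have [[B _ hB] _] := fourier_sum S0P fourF (Zt j).
  have := @fourier_coefficient_bound _ _ (fun c => ac c * ee (pairing c (Z j))) _ M c M0 hB.
  rewrite normrM norm_ee Im_pairing; apply=> X.
  exists (F (wZ S0 (Z j + map_mx toC X))) => //.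
  have ht : inTube S0 (Z j + map_mx toC X).
    rewrite /inTube; suff -> : ImV (Z j + map_mx toC X) = ImV (Z j) by exact: Zt.
    by move: (Z j) => W; apply/rowP => i; rewrite !mxE ReImE /= addr0.
  have [_ hl] := fourier_sum S0P fourF ht; apply: (tends_eq hl); exists 0%N => N _.
  by rewrite /box_sum; apply: eq_bigr => f _; rewrite pairingD eeD mulrA pairing_map.
apply/eqP/negPn/negP => ac0.
have nE := ge0_Cr (normr_ge0 (ac c)); set A := complex.Re _ in nE.
have A0 : 0 < A by rewrite -lt_Cr -nE normr_gt0.
pose x : R := pairing c (map_mx intr v1); pose y : R := pairing c Y0.
(* Both q and the coordinate of c are negative integers, so w >= 1 and the pairing of c with Im Z_j
   tends to minus infinity quadratically in j. *)
pose w : R := (q * c 0 (lshift m 1))%:~R.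
have w1 : 1 <= w by rewrite /w -[1]/(1%:~R) ler_int; nia.
have [j hj] := quadratic_escape x y (M / A) w1.
have PE : pairing c (ImV (Z j)) = - (j%:R * j%:R * w - j%:R * x - y).
  rewrite YE !pairingD -scaleNr pairingZ.
  rewrite [pairing c (map_mx intr e)](_ : _ = (c 0 (lshift m 1))%:~R).
    rewrite /V map_mxZ pairingZ -/x -/y /w /Q /intr !rmorphM /= -pmulrn; ring.
  rewrite /pairing (bigD1 (lshift m 1)) //= big1 ?addr0 => [|i /negPf ne].
    by rewrite !mxE !eqxx /intr /= mulr1z mulr1.
  by rewrite !mxE ne andbF /intr mulr0z mulr0.
set P := j%:R * j%:R * w - j%:R * x - y in hj PE.
have MA : 0 <= M / A by rewrite divr_ge0 // ltW.
have := key j; rewrite PE nE -CrM le_Cr mulrN opprK leNgt => /negP; apply.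
have h1 := expR_ge1Dx (2 * pi * P).
have p2 := pi_ge2 R.
have hP : P <= 2 * pi * P by rewrite ler_peMl //; lra.
have : A * (M / A) < A * expR (2 * pi * P) by rewrite ltr_pM2l //; lra.
by rewrite mulrC mulfVK ?gt_eqF.
Qed.

Hypothesis vanish : forall l, inDual L1 l -> bil L1 l l = 0 -> a l = 0.

Lemma dualvec_dual c : inDual L1 (dualvec S0 c).
Proof. by exists c; rewrite /dualvec mulmxKV // (unit_L1 S0P). Qed.

(** The expansion gives (l,l) >= 0, [vanish] excludes 0, and [koecher] excludes a negative first
    coordinate; a zero first coordinate would leave only the nonpositive norm of the L0 part. *)
Lemma coef_support c : ac c != 0 ->
  posCone S0 (map_mx (ratr : rat -> R) (dualvec S0 c)).
Proof.
move=> c0; set l := map_mx _ _.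
have l0 : l 0 (lshift m 0) = (c 0 (lshift m 1))%:~R.
  pose e : 'rV[R]_(2 + m) := delta_mx 0 (lshift m 1).
  transitivity (bil L1 l e).
    rewrite bil1E [rsubmx e](_ : _ = 0).
      by rewrite bil0r !mxE !eqxx /= mulr0 mulr1 !addr0.
    by apply/rowP => i; rewrite !mxE.
  rewrite (pairing_dualvec S0P) /pairing (bigD1 (lshift m 1)) //= big1 ?addr0 => [|i /negPf ne].
    by rewrite !mxE !eqxx mulr1.
  by rewrite !mxE ne andbF mulr0.
have lle : 0 <= bil L1 (dualvec S0 c) (dualvec S0 c) by apply: fourF.1 c0; apply: dualvec_dual.
have ll : 0 < bil L1 l l.
  rewrite bil_map ltr0q lt0r lle andbT; apply: contra c0 => /eqP h.
  by apply/eqP/vanish => //; apply: dualvec_dual.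
have c1 : 0 <= c 0 (lshift m 1).
  by rewrite leNgt; apply/negP => /koecher h; rewrite h eqxx in c0.
split=> //; rewrite l0 lt0r ler0z c1 andbT intr_eq0; apply: contraTneq ll => h.
by rewrite bil1E l0 h mulr0z mul0r mulr0 !add0r -leNgt; apply: (negdef_le0 S0P).
Qed.

End Koecher.

(** * Decay at the boundary *)

Section BoundaryRays.
Variables (R : realType) (m : nat) (S0 : 'M[int]_m).
Hypotheses (m1 : (1 <= m)%N) (S0P : even_negdef_gram R S0).
Local Notation C := R[i].
Local Notation toC := (real_complex R).
Local Notation L1 := (Gram1 S0).
Local Notation L := (GramL S0).
Variables (k : int) (F : 'rV[C]_(2 + (2 + m)) -> C) (a : 'rV[rat]_(2 + m) -> C).
Hypothesis cyc : isotropic_subgroups_cyclic L.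
Hypotheses (modF : isModularForm S0 k F) (fourF : FourierExpansion S0 F a).
Hypothesis vanish : forall l, inDual L1 l -> bil L1 l l = 0 -> a l = 0.
Local Notation ac c := (a (dualvec S0 c)).

Lemma ratr_toC (q : rat) : (ratr q : C) = toC (ratr q).
Proof. by rewrite (fmorph_rat toC). Qed.

Lemma map_ratr_toC k' l (A : 'M[rat]_(k', l)) :
  map_mx (@ratC R) A = map_mx toC (map_mx ratr A).
Proof. by apply/matrixP => i j; rewrite !mxE /ratC ratr_toC. Qed.

Lemma ImV_shift (Z : 'rV[C]_(2 + m)) (s : C) (Y : 'rV[rat]_(2 + m)) :
  ImV (Z + s *: map_mx (@ratC R) Y) = ImV Z + complex.Im s *: map_mx ratr Y.
Proof. by rewrite map_ratr_toC; apply/rowP => i; rewrite !mxE !ReImE /=; ring. Qed.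

Lemma map_ratr_neq0 (Y : 'rV[rat]_(2 + m)) : Y != 0 -> map_mx (ratr : rat -> R) Y != 0.
Proof.
apply: contra => /eqP/rowP h; apply/eqP/rowP => i.
by have := h i; rewrite !mxE => /eqP; rewrite fmorph_eq0 => /eqP.
Qed.

Lemma tube_shift (Z : 'rV[C]_(2 + m)) (s : C) (Y : 'rV[rat]_(2 + m)) :
  inTube S0 Z -> closPosConeQ S0 Y -> bil L1 Y Y = 0 -> 0 <= complex.Im s ->
  inTube S0 (Z + s *: map_mx (@ratC R) Y).
Proof.
move=> hZ [Y0 [_ [Y00 Y01]]] YY s0; rewrite /inTube ImV_shift.
apply: posCone_shift => //; first exact: map_ratr_neq0.
- by rewrite bil_map YY rmorph0.
- by rewrite mxE ler0q.
- by rewrite !mxE ler0q.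
Qed.

(** With u = 2 pi t / D the ratio is 1 / (exp u - 1), at most 1 / u. *)
Lemma geometric_ratio_le (D t : R) : 0 < D -> 0 < t ->
  let rho := expR (- (2 * pi * (t / D))) in
  0 <= rho < 1 /\ rho / (1 - rho) <= D / t.
Proof.
move=> D0 t0 rho; set u := 2 * pi * (t / D) in rho *.
have tD : 0 < t / D by rewrite divr_gt0.
have p2 := pi_ge2 R.
have ut : t / D <= u by rewrite ler_peMl ?(ltW tD) //; lra.
have r0 : 0 < rho := expR_gt0 _.
have re : rho * expR u = 1 by rewrite -expRD addNr expR0.
have hu : rho * (1 + u) <= rho * expR u.
  by apply: ler_wpM2l; [exact: ltW|exact: expR_ge1Dx].
have ru : rho * (t / D) <= rho * u by apply: ler_wpM2l => //; exact: ltW.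
have rt : 0 < rho * (t / D) by rewrite mulr_gt0.
have r1 : 0 < 1 - rho by lra.
split; first by rewrite (ltW r0) /=; lra.
have dt : D / t * (t / D) = 1.
  by rewrite mulrA mulfVK ?gt_eqF // divff ?gt_eqF.
by rewrite ler_pdivrMr // -(ler_pM2r tD) [leRHS]mulrAC dt mul1r; lra.
Qed.

(* Along an isotropic direction [F] is, up to an automorphy factor, a power series in
   [q = e(s / D)] without constant term. *)
Lemma boundary_ray (h : 'M[rat]_(2 + (2 + m))) (Y1 : 'rV[rat]_(2 + m)) :
  inOplusQ R S0 h -> closPosConeQ S0 Y1 -> bil L1 Y1 Y1 = 0 ->
  exists2 D : R, 0 < D & forall Z, inTube S0 Z ->
  let phi s := F (wZ S0 (Z + s *: map_mx (@ratC R) Y1) *m map_mx (@ratC R) h) in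
  [/\ exists2 M : R, 0 <= M & forall x, `|phi (Cr x)| <= Cr M,
      forall (x : R) (n : int), phi (Cr (x + n%:~R * D)) = phi (Cr x) &
      forall M : R, 0 <= M -> (forall x, `|phi (Cr x)| <= Cr M) ->
        forall t, 0 < t -> `|phi (Cr t * 'i)| <= Cr (M * (D / t))].
Proof.
move=> hO Y1c YY; have [Y10 _] := Y1c.
have [g [Y2 [gG Y20 YY2 tr]]] := boundary_transfer S0P cyc hO Y10 YY.
(* The frequencies (l, Y2) with l in L1^v lie in Z / D0. This denominator is fixed before Z, so one
   period serves all base points. *)
have [c0 c0n [y0 y0E]] := common_denominator Y2.
pose D0 : int := `|c0|; pose y := sgz c0 *: y0.
have D00 : 0 < D0 by rewrite normr_gt0.
have yE : map_mx intr y = D0%:~R *: Y2.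
  by rewrite /y map_mxZ y0E scalerA /intr -intrM -abszEsg.
pose D : R := D0%:~R; have Dp : 0 < D by rewrite ltr0z.
pose nu c := pairing c y.
have nuE (K : numFieldType) c : pairing c (map_mx (ratr : rat -> K) Y2) = (nu c)%:~R / D0%:~R.
  have DK : (D0%:~R : K) != 0 by rewrite intr_eq0 gt_eqF.
  apply: (mulIf DK); rewrite mulfVK // mulrC -[LHS]pairingZ.
  have -> : D0%:~R *: map_mx ratr Y2 = map_mx intr y :> 'rV[K]_(2 + m).
    rewrite -(rmorph_int ratr) -map_mxZ -yE; apply/rowP => i.
    by rewrite !mxE /intr rmorph_int.
  exact: (pairing_map intr).
exists D; first exact: Dp.
move=> Z hZ phi.
have [J [Z' [J0 hZ' wE]]] := tr Z hZ.
have phiT s : 0 <= complex.Im s -> inTube S0 (Z' + s *: map_mx (@ratC R) Y2) /\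
    phi s = J ^ (- k) * F (wZ S0 (Z' + s *: map_mx (@ratC R) Y2)).
  move=> s0; have ht := tube_shift hZ Y1c YY s0.
  have hc : inConeD S0 (wZ S0 (Z + s *: map_mx (@ratC R) Y1) *m map_mx (@ratC R) h).
    by case: hO => _ [_]; apply; apply: inConeD_wZ.
  have := F_gamma modF gG hc; have := gG.2.2.2 _ hc; rewrite wE => hc' FE; rewrite /phi -FE.
  have ht' := inTube_cone S0P J0 hc'; split=> //.
  by case: modF => _ [-> //]; apply: inConeD_wZ.
(* The transfer does not say on which side of the light cone [Y2] lies; a ray that stays in the tube
   decides it. *)
have Y2ray : forall t, 0 <= t -> posCone S0 (ImV Z' + t *: map_mx ratr Y2).
  move=> t t0; have [] := phiT (Complex 0 t) t0.
  by rewrite /inTube ImV_shift.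
have YY2R : bil L1 (map_mx ratr Y2) (map_mx ratr Y2) = 0 :> R by rewrite bil_map YY2 rmorph0.
have [Y2c Y2c'] := lightcone_ray S0P YY2R Y2ray.
have nu0 c : ac c != 0 -> 0 < nu c.
  move=> /(coef_support m1 S0P modF fourF vanish) hl.
  have := lightcone_pos S0P hl (map_ratr_neq0 Y20) YY2R Y2c Y2c'.
  by rewrite (pairing_dualvec S0P) nuE pmulr_lgt0 ?invr_gt0 ?ltr0z.
pose b c := J ^ (- k) * (ac c * ee (pairing c Z')).
have series s : 0 <= complex.Im s ->
    tends (fun N => box_sum N (fun c => b c * ee (s * ((nu c)%:~R / D0%:~R)))) (phi s).
  move=> /phiT[ht ->]; have [_ hl] := fourier_sum S0P fourF ht.
  apply: (tends_eq (tendsM (J ^ (- k)) hl)); exists 0%N => N _.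
  rewrite /box_sum mulr_sumr; apply: eq_bigr => f _.
  by rewrite pairingD pairingZ -(nuE C) eeD /b !mulrA.
have [[B B0 hB] _] := fourier_sum S0P fourF hZ'.
have JE := ge0_Cr (normr_ge0 (J ^ (- k))); set j := complex.Re _ in JE.
have j0 : 0 <= j by rewrite -le_Cr -JE; exact: normr_ge0.
have bB N : box_sum N (fun c => `|b c|) <= Cr (j * B).
  rewrite CrM -JE /box_sum.
  under eq_bigr do rewrite /b normrM.
  by rewrite -mulr_sumr ler_wpM2l // -?JE //; apply: hB.
have D0C : (D0%:~R : C) != 0 by rewrite intr_eq0 gt_eqF.
split.
- have [M M0 hM] := F_bounded S0P fourF hZ'.
  exists (j * M) => [|x]; first exact: mulr_ge0.
  have [|_ ->] := phiT (Cr x); first by [].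
  rewrite normrM JE CrM; apply: ler_wpM2l; first by rewrite -JE; exact: normr_ge0.
  by have := hM (x *: map_mx ratr Y2); rewrite map_mxZ -map_ratr_toC.
- move=> x n; apply: (tends_unique (series _ (lexx _ : 0 <= complex.Im (Cr _)))).
  apply: (tends_eq (series (Cr x) (lexx _))); exists 0%N => N _.
  rewrite /box_sum; apply: eq_bigr => f _; set c := (\row_i _).
  rewrite [Cr (x + _)]CrD mulrDl eeD [X in _ = _ * (_ * X)](_ : _ = 1) ?mulr1 //.
  rewrite CrM /D !Cr_int -mulrA [D0%:~R * _]mulrC mulfVK // -intrM.
  exact: ee_int.
move=> M M0 hM t t0; have [rr rle] := geometric_ratio_le Dp t0.
set rho := expR _ in rr rle.
apply: (@le_trans _ _ (Cr (M * (rho / (1 - rho))))); last first.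
  by rewrite le_Cr ler_wpM2l.
apply: (schwarz_bound (nu := nu) M0 rr bB) => [c|x|].
- by rewrite !mulf_eq0 !negb_or => /andP[_ /andP[/nu0]].
- exists (phi (Cr (x * D))); first exact: hM.
  apply: (tends_eq (series (Cr (x * D)) (lexx _))); exists 0%N => N _.
  rewrite /box_sum; apply: eq_bigr => f _; congr (_ * ee _).
  by rewrite !CrM /D !Cr_int -mulrA; congr (_ * _); rewrite mulrC mulfVK.
have it0 : complex.Im (Cr t * 'i : C) = t by rewrite -complexiE !ReImE /=; ring.
have it1 : complex.Re (Cr t * 'i : C) = 0 by rewrite -complexiE !ReImE /=; ring.
have := series (Cr t * 'i); rewrite it0 => /(_ (ltW t0)) hs.
apply: (tends_eq hs); exists 0%N => N _; rewrite /box_sum; apply: eq_bigr => f _.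
set c := (\row_i _); have [->|b0] := eqVneq (b c) 0; first by rewrite !mul0r.
have nc : 0 < nu c by move: b0; rewrite !mulf_eq0 !negb_or => /andP[_ /andP[/nu0]].
congr (_ * _).
have -> : Cr t * 'i * ((nu c)%:~R / D0%:~R) = Complex 0 (t * ((nu c)%:~R / D)) :> C.
  have -> : (nu c)%:~R / D0%:~R = Cr ((nu c)%:~R / D) :> C by rewrite CrM CrV /D !Cr_int.
  by apply: complex_eq; [rewrite Re_mul it0 it1 /=|rewrite Im_mul it0 it1 /=]; ring.
rewrite ee_complex /= !mulr0 cos0 sin0 mulr1 mulr0; congr Cr.
rewrite /rho -expRM_natl; congr expR.
have -> : (nu c)%:~R = `|nu c|%N%:R :> R by rewrite natr_absz gtr0_norm.
by ring.
Qed.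

End BoundaryRays.

(** * Boundedness on compact families of the cone *)

Section Rectangle.
Variables (R : realType) (m : nat) (S0 : 'M[int]_m).
Local Notation C := R[i].
Local Notation iF := (lshift (2 + m) (1 : 'I_2)).
Variables (k : int) (F : 'rV[C]_(2 + (2 + m)) -> C).
Hypothesis modF : isModularForm S0 k F.
Local Open Scope classical_set_scope.

Lemma cvg_Cr (T : Type) (fil : set_system T) (Ff : Filter fil) (f : T -> R) (l : R) :
  f @ fil --> l -> ((fun x => Cr (f x) : C^o) @ fil --> (Cr l : C^o)).
Proof.
move=> /cvgrPdist_lt h; apply/cvgrPdist_lt => e e0.
have eE := ge0_Cr (ltW e0); have e1 : 0 < complex.Re e by rewrite -lt_Cr -eE.
apply: filterS (h _ e1) => x hx; rewrite eE -CrN -CrD.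
by rewrite normc_def /= expr0n addr0 sqrtr_sqr; rewrite -/(Cr _) lt_Cr.
Qed.

Lemma cvgC_near (T : Type) (fil : set_system T) (Ff : Filter fil) (f : T -> C) (l : C)
    (d : R) : ((f : T -> C^o) @ fil --> (l : C^o)) -> 0 < d ->
  \forall t \near fil, `|f t - l| < Cr d.
Proof.
move=> h d0; have dC : 0 < Cr d by rewrite -[0]/(Cr 0) lt_Cr.
have hh := (cvgrPdist_lt _ _).1 h (Cr d) dC.
by apply: (@filterS _ fil Ff _ _ _ (hh Ff)) => t /=; rewrite distrC.
Qed.

(** Stated for y near x and all large t, the form in which compactness is used as a covering
    property. *)
Lemma F_locally_bounded (U0 U1 U2 U12 : 'rV[C]_(2 + (2 + m))) :
  let u (y : R * R) := U0 + Cr y.1 *: U1 + Cr y.2 *: U2 + (Cr y.1 * Cr y.2) *: U12 in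
  (forall y, inConeD S0 (u y)) ->
  forall x : R * R, \forall y \near nbhs x & t \near (+oo : set_system R), `|F (u y)| <= Cr t.
Proof.
move=> u uD x.
have uc i : (fun y => u y 0 i : C^o) @ x --> (u x 0 i : C^o).
  have -> : (fun y => u y 0 i : C^o) = (fun y => U0 0 i + Cr y.1 * U1 0 i +
      Cr y.2 * U2 0 i + (Cr y.1 * Cr y.2) * U12 0 i : C^o).
    by apply/funext => y; rewrite /u !rowE_lin.
  have c1 : (fun y : R * R => Cr y.1 : C^o) @ x --> (Cr x.1 : C^o).
    by apply: cvg_Cr; exact: cvg_fst.
  have c2 : (fun y : R * R => Cr y.2 : C^o) @ x --> (Cr x.2 : C^o).
    by apply: cvg_Cr; exact: cvg_snd.
  rewrite /u !rowE_lin.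
  apply: (@cvgD _ C^o); [apply: (@cvgD _ C^o); [apply: (@cvgD _ C^o)|]|].
  - exact: cvg_cst.
  - by apply: (@cvgM C); [exact: c1|exact: cvg_cst].
  - by apply: (@cvgM C); [exact: c2|exact: cvg_cst].
  - by apply: (@cvgM C); [apply: (@cvgM C); [exact: c1|exact: c2]|exact: cvg_cst].
(* The coordinates (scale, Z) in which holomorphy of F is stated; continuity there with tolerance 1
   gives the bound |F(u x)| + 1. *)
pose p y : 'rV[C]_(1 + (2 + m)) := row_mx (u y 0 iF)%:M ((u y 0 iF)^-1 *: rsubmx (u y)).
have uE y : exists t Z, [/\ t != 0, inTube S0 Z, u y 0 iF = t & u y = t *: wZ S0 Z].
  have [t [t0 [Z [hZ e]]]] := uD y; exists t, Z; split=> //.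
  by rewrite e rowE_lin wZ_F mulr1.
have pE y : p y 0 (lshift _ 0) != 0 /\ inTube S0 (rsubmx (p y)) /\
    u y = p y 0 (lshift _ 0) *: wZ S0 (rsubmx (p y)).
  have [t [Z [t0 hZ tE e]]] := uE y.
  rewrite /p row_mxKr row_mxEl tE mxE eqxx mulr1n e rsub_scaleE rsub_wZ scalerA mulVf //.
  by rewrite scale1r.
have pc i : (fun y => p y 0 i : C^o) @ x --> (p x 0 i : C^o).
  case: (splitP i) => j ij.
    have -> : i = lshift _ j by apply/val_inj.
    have -> : (fun y => p y 0 (lshift _ j)) = (fun y => u y 0 iF : C^o).
      by apply/funext => y; rewrite /p row_mxEl mxE !ord1 eqxx mulr1n.
    by rewrite /p row_mxEl mxE !ord1 eqxx mulr1n; exact: uc.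
  have -> : i = rshift 1 j by apply/val_inj.
  have -> : (fun y => p y 0 (rshift 1 j)) =
      (fun y => (u y 0 iF)^-1 * u y 0 (rshift 2 j) : C^o).
    by apply/funext => y; rewrite /p row_mxEr !mxE.
  have -> : p x 0 (rshift 1 j) = (u x 0 iF)^-1 * u x 0 (rshift 2 j).
    by rewrite /p row_mxEr !mxE.
  have uF : u x 0 iF != 0 by have [t [Z [t0 _ -> _]]] := uE x.
  exact: (@cvgM C _ _ _ _ _ _ _ (@cvgV C _ _ _ _ _ uF (uc iF)) (uc (rshift 2 j))).
case: modF => -[hol _] _.
clearbody p; clearbody u.
have [p0 [pt ex]] := pE x; have [d d0 hd] := hol (p x) (conj p0 pt) 1 ltr01.
have near_p : \forall y \near nbhs x, forall i, `|p y 0 i - p x 0 i| < Cr d.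
  by apply: (@filter_forall _ _ _ (nbhs x)) => i; apply: cvgC_near (pc i) d0.
have nE := ge0_Cr (normr_ge0 (F (u x))); set B := complex.Re _ in nE.
exists ([set y | forall i, `|p y 0 i - p x 0 i| < Cr d], [set t | B + 1 < t]).
  split=> //=; exists (B + 1); split=> //; exact: num_real.
move=> [y t] /= [hy ht]; have [_ [_ ey]] := pE y.
have h : `|F (u y) - F (u x)| < Cr 1 by rewrite ey ex; exact: hd hy.
apply: (@le_trans _ _ (Cr (B + 1))); last by rewrite le_Cr ltW.
rewrite -[F (u y)](subrK (F (u x))) addrC (le_trans (ler_normD _ _)) // CrD -nE.
by rewrite lerD2l ltW.
Qed.

Lemma F_bounded_rectangle (U0 U1 U2 U12 : 'rV[C]_(2 + (2 + m))) (D1 D2 : R) :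
  let u (y : R * R) := U0 + Cr y.1 *: U1 + Cr y.2 *: U2 + (Cr y.1 * Cr y.2) *: U12 in
  (forall y, inConeD S0 (u y)) ->
  exists2 M : R, 0 <= M & forall x1 x2, 0 <= x1 <= D1 -> 0 <= x2 <= D2 ->
    `|F (u (x1, x2))| <= Cr M.
Proof.
move=> u uD.
have K : compact (`[0, D1] `*` `[0, D2] : set (R * R)).
  exact: compact_setX (@segment_compact R 0 D1) (@segment_compact R 0 D2).
have nc := (compact_near_coveringP _).1 K R (+oo) (fun t y => `|F (u y)| <= Cr t) _.
have [t0 [_ ht]] := nc _ (fun x _ => F_locally_bounded uD x).
exists (`|t0| + 1) => [|x1 x2 h1 h2]; first by rewrite addr_ge0.
apply: (ht (`|t0| + 1)); first by have := ler_norm t0; lra.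
by split; rewrite /= in_itv.
Qed.

End Rectangle.

Section CuspForm.
Variables (R : realType) (m : nat) (S0 : 'M[int]_m).
Hypotheses (m1 : (1 <= m)%N) (S0P : even_negdef_gram R S0).
Local Notation C := R[i].
Local Notation toC := (real_complex R).
Local Notation L1 := (Gram1 S0).
Local Notation L := (GramL S0).
Local Notation iE := (lshift (2 + m) (0 : 'I_2)).
Variables (k : int) (F : 'rV[C]_(2 + (2 + m)) -> C) (a : 'rV[rat]_(2 + m) -> C).
Hypothesis cyc : isotropic_subgroups_cyclic L.
Hypotheses (modF : isModularForm S0 k F) (fourF : FourierExpansion S0 F a).
Hypothesis vanish : forall l, inDual L1 l -> bil L1 l l = 0 -> a l = 0.

Lemma negdefQ_le0 (v : 'rV[rat]_m) : bil S0 v v <= 0.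
Proof. by rewrite -(lerq0 R) -bil_map; apply: (negdef_le0 S0P). Qed.

Lemma wZ_shift2 (Z Y Y' : 'rV[C]_(2 + m)) (s s' : C) :
  bil L1 Y Y = 0 -> bil L1 Y' Y' = 0 ->
  wZ S0 (Z + s *: Y + s' *: Y') = wZ S0 Z
    + s *: (row_mx 0 Y - bil L1 Z Y *: delta_mx 0 iE)
    + s' *: (row_mx 0 Y' - bil L1 Z Y' *: delta_mx 0 iE)
    + (s * s') *: (- bil L1 Y Y' *: delta_mx 0 iE).
Proof.
move=> YY YY'; rewrite (wZ_shift S0P (Z + s *: Y) s' YY') (wZ_shift S0P Z s YY).
rewrite (bilDl L1 Z) (bilZl L1 s).
move: (wZ S0 Z) (row_mx 0 Y) (row_mx 0 Y') (delta_mx 0 iE) => w r r' d.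
move: (bil L1 Z Y) (bil L1 Z Y') (bil L1 Y Y') => b b' b''.
by apply/rowP => i; rewrite !rowE_lin; ring.
Qed.

Lemma reduce_period (D x : R) : 0 < D -> exists (n : int), 0 <= x + n%:~R * D <= D.
Proof.
move=> D0; exists (- Num.floor (x / D)).
have /andP[h1 h2] := Num.Theory.floor_itv (x / D).
rewrite ler_pdivlMr // in h1; rewrite ltr_pdivrMr // in h2.
rewrite intrD mulrDl mul1r in h2; rewrite mulrNz mulNr; apply/andP; split; lra.
Qed.

(* A positive direction is a sum of two isotropic ones, and Schwarz's bound is applied
   in each of the two variables. *)
Lemma cusp_decay (h : 'M[rat]_(2 + (2 + m))) (Z : 'rV[C]_(2 + m)) (Y0 : 'rV[rat]_(2 + m)) :
  inOplusQ R S0 h -> inTube S0 Z -> closPosConeQ S0 Y0 ->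
  exists2 B : R, 0 <= B & forall t, 1 <= t ->
    `|F (wZ S0 (Z + (Cr t * 'i) *: map_mx (@ratC R) Y0) *m map_mx (@ratC R) h)| <= Cr (B / t).
Proof.
move=> hO hZ Y0c; have := Y0c => -[Y0n [YY [Y00 Y01]]].
have [YY0|YYn] := eqVneq (bil L1 Y0 Y0) 0.
  have [D D0 hD] := boundary_ray m1 S0P cyc modF fourF vanish hO Y0c YY0.
  have [[M M0 hM] _ dec] := hD Z hZ.
  exists (M * D) => [|t t1]; first by rewrite mulr_ge0 // ltW.
  by rewrite -mulrA; apply: dec => //; lra.
have {}YY : 0 < bil L1 Y0 Y0 by rewrite lt0r YYn.
set y0 := Y0 0 (lshift m 0) in Y00.
have y0p : 0 < y0.
  rewrite lt0r Y00 andbT; apply: contraTneq YY => y00; rewrite -leNgt.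
  by rewrite bil1E -/y0 y00 mul0r mulr0 !add0r negdefQ_le0.
pose e : 'rV[rat]_(2 + m) := delta_mx 0 (lshift m 1).
have e0 : e 0 (lshift m 0) = 0 by rewrite !mxE.
have e1 : e 0 (lshift m 1) = 1 by rewrite !mxE !eqxx.
have er : rsubmx e = 0 by apply/rowP => i; rewrite !mxE.
(* The solution of (Y0 - cc e, Y0 - cc e) = (Y0,Y0) - 2 cc y0 = 0. *)
pose cc := bil L1 Y0 Y0 / (2 * y0).
have cp : 0 < cc by rewrite divr_gt0 // mulr_gt0.
pose Y1 := cc *: e; pose Y2 := Y0 - Y1.
have ee : bil L1 e e = 0 by rewrite bil1E e0 er bil0l; ring.
have Y0e : bil L1 Y0 e = y0 by rewrite bil1E e0 e1 er bil0r -/y0; ring.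
have YY1 : bil L1 Y1 Y1 = 0 by rewrite !bilE ee; ring.
have YY2 : bil L1 Y2 Y2 = 0.
  rewrite !bilE (bilC (symGram1 S0P) e) ee Y0e /cc; field.
  by rewrite gt_eqF.
have Y1c : closPosConeQ S0 Y1.
  split; [|split; [|split]]; rewrite ?YY1 ?rowE_lin ?e0 ?e1 ?mulr0 ?mulr1 ?(ltW cp) //.
  apply/eqP => /rowP/(_ (lshift m 1)); rewrite rowE_lin e1 mulr1 mxE => cc0.
  by rewrite cc0 ltxx in cp.
have Y20 : Y2 0 (lshift m 0) = y0 by rewrite !rowE_lin e0 mulr0 subr0.
have Y2c : closPosConeQ S0 Y2.
  split; [|split; [|split]]; rewrite ?YY2 ?Y20 ?(ltW y0p) //.
    by apply/eqP => Y2z; move: y0p; rewrite -Y20 Y2z mxE ltxx.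
  have := negdefQ_le0 (rsubmx Y2); move: YY2; rewrite bil1E Y20.
  set y := Y2 0 _; set s := bil _ _ _ => h1 h2.
  by rewrite -(pmulr_rge0 _ y0p); lra.
have [D1 D10 h1] := boundary_ray m1 S0P cyc modF fourF vanish hO Y1c YY1.
have [D2 D20 h2] := boundary_ray m1 S0P cyc modF fourF vanish hO Y2c YY2.
pose y1 := map_mx (@ratC R) Y1; pose y2 := map_mx (@ratC R) Y2.
have y12 : map_mx (@ratC R) Y0 = y1 + y2.
  by rewrite /y1 /y2 -[Y0 in LHS](subrK Y1) addrC; exact: (map_mxD (@ratr C)).
pose H := map_mx (@ratC R) h.
have y11 : bil L1 y1 y1 = 0 by rewrite /y1 (bil_map (@ratr C)) YY1 rmorph0.
have y22 : bil L1 y2 y2 = 0 by rewrite /y2 (bil_map (@ratr C)) YY2 rmorph0.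
pose psi s1 s2 := F (wZ S0 (Z + s1 *: y1 + s2 *: y2) *m H).
have t1 s : 0 <= complex.Im s -> inTube S0 (Z + s *: y1) by apply: tube_shift.
have t2 s : 0 <= complex.Im s -> inTube S0 (Z + s *: y2) by apply: tube_shift.
pose V1 := row_mx 0 y1 - bil L1 Z y1 *: delta_mx 0 iE.
pose V2 := row_mx 0 y2 - bil L1 Z y2 *: delta_mx 0 iE.
pose V12 : 'rV[C]_(2 + (2 + m)) := - bil L1 y1 y2 *: delta_mx 0 iE.
have psiE (y : R * R) : wZ S0 (Z + Cr y.1 *: y1 + Cr y.2 *: y2) *m H =
    wZ S0 Z *m H + Cr y.1 *: (V1 *m H) + Cr y.2 *: (V2 *m H) + (Cr y.1 * Cr y.2) *: (V12 *m H).
  by rewrite wZ_shift2 // !scalemxAl -!mulmxDl.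
have [|M M0 hM] := F_bounded_rectangle modF
   (U0 := wZ S0 Z *m H) (U1 := V1 *m H) (U2 := V2 *m H) (U12 := V12 *m H) D1 D2.
  move=> y; rewrite -psiE; case: hO => _ [_]; apply; apply: inConeD_wZ.
  by apply: tube_shift => //; apply: t1.
(* Neither period depends on the other variable, so both can be reduced to the rectangle in turn. *)
have bnd x1 x2 : `|psi (Cr x1) (Cr x2)| <= Cr M.
  have [n1 hn1] := reduce_period x1 D10; have [n2 hn2] := reduce_period x2 D20.
  have [_ per1 _] := h1 _ (t2 (Cr x2) (lexx _)).
  have [_ per2 _] := h2 _ (t1 (Cr (x1 + n1%:~R * D1)) (lexx _)).
  have := hM _ _ hn1 hn2; rewrite -psiE /=.
  by rewrite (per2 x2 n2) addrAC (per1 x1 n1) addrAC.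
exists (M * D2 * D1) => [|t tge1]; first by rewrite !mulr_ge0 // ltW.
have t0 : 0 < t by lra.
have it0 : complex.Im (Cr t * 'i : C) = t.
  by rewrite -complexiE Im_mul /=; ring.
have b1 x1 : `|psi (Cr x1) (Cr t * 'i)| <= Cr (M * (D2 / t)).
  have [_ _ dec] := h2 _ (t1 (Cr x1) (lexx _)).
  by apply: dec => // x2; apply: bnd.
have M'0 : 0 <= M * (D2 / t) by rewrite mulr_ge0 // divr_ge0 // ltW.
have [|_ _ dec] := h1 (Z + (Cr t * 'i) *: y2); first by apply: t2; rewrite it0 ltW.
rewrite y12 scalerDr addrA (addrAC Z); apply: (le_trans (dec _ M'0 _ _ t0)).
  by move=> x; rewrite (addrAC Z); exact: b1.
rewrite le_Cr.
(* Each variable contributes a factor 1/t; one of them is dropped, by t >= 1, to match the isotropic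
   case. *)
have -> : M * (D2 / t) * (D1 / t) = M * D2 * D1 / t * t^-1 by ring.
by rewrite ler_piMr ?invf_le1 // divr_ge0 // ?mulr_ge0 // ltW.
Qed.

End CuspForm.

(* L = 2U + L0 with L0 = (Z^m, S0), so n = m + 2 >= 3 iff m >= 1. *)
Theorem theorem5p2 (R : realType) (m : nat) (S0 : 'M[int]_m) (k : int)
    (F : 'rV[R[i]]_(2 + (2 + m)) -> R[i]) (a : 'rV[rat]_(2 + m) -> R[i]) :
  (1 <= m)%N ->
  even_negdef_gram R S0 ->
  isotropic_subgroups_cyclic (GramL S0) ->
  isModularForm S0 k F ->
  FourierExpansion S0 F a ->
  (forall l, inDual (Gram1 S0) l -> bil (Gram1 S0) l l = 0 -> a l = 0) ->
  isCuspForm S0 F.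
Proof.
move=> m1 S0P cyc modF fourF vanish h hO Z hZ Y0 Y0c.
have [B B0 hB] := cusp_decay m1 S0P cyc modF fourF vanish hO hZ Y0c.
apply: cvg_pinfty => e e0.
(* The summand 1 ensures t >= 1, where the decay estimate holds, and makes B / e < t strict. *)
exists (B / e + 1) => t ht.
have Be : 0 <= B / e by rewrite divr_ge0 // ltW.
have t1 : 1 <= t by lra.
apply: le_lt_trans (hB t t1) _; rewrite lt_Cr ltr_pdivrMr; last by lra.
have : B / e < t by lra.
by rewrite ltr_pdivrMr // mulrC.
Qed.
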